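(* Let $r\ge2$ be an integer, let $\{G_n\}_{n\ge1}$ be a sequence of deterministic finite simple graphs, let $\{c_n\}_{n\ge 1}$ be positive integers with $c_n\to\infty$, and let $\lambda_1,\dots,\lambda_{r+1}\ge0$. For each $n$, color the vertices of $G_n$ independently and uniformly at random with $c_n$ colors, and let $T(K_{1,r},G_n)$ be the number of monochromatic $r$-stars. The following are equivalent: (a) $\displaystyle\lim_{n\to\infty}\frac1{c_n^r}\sum_{F\in\mathcal C_{r,k}}N_{\mathrm{ind}}(F,G_n)=\lambda_k$ for every $k\in\{1,\dots,r+1\}$, and $\displaystyle\lim_{n\to\infty}\frac{\Delta(G_n)}{c_n}=0$, where $\Delta(G_n)=\max_{v\in V(G_n)}d_v$ is the maximum degree of $G_n$. (b) $T(K_{1,r},G_n)$ converges in distribution to $\sum_{k=1}^{r+1}kZ_k$, where $Z_1,\dots,Z_{r+1}$ are independent with $Z_k\sim\mathrm{Pois}(\lambda_k)$.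
   Context: $K_{1,r}$ is the $r$-star. If $X_v$ is the color of $v$ (i.i.d. uniform on $\{1,\dots,c_n\}$), then $$T(K_{1,r},G_n)=\sum_{v\in V(G_n)}\ \sum_{\{u_1,\dots,u_r\}\subseteq V(G_n)}\ \prod_{s=1}^r a_{vu_s}(G_n)\ \mathbf 1\{X_v=X_{u_1}=\cdots=X_{u_r}\},$$ where the inner sum is over $r$-element subsets and $(a_{uv}(G_n))$ is the adjacency matrix. $N(H,G)$ is the number of (not necessarily induced) subgraphs of $G$ isomorphic to $H$; $N_{\mathrm{ind}}(F,G)$ is the number of induced copies of $F$ in $G$, i.e. the number of vertex subsets of $G$ inducing a graph isomorphic to $F$. $\mathcal C_{r,k}$ is the set of (isomorphism classes of) graphs $F\supseteq K_{1,r}$ with $|V(F)|=r+1$ and $N(K_{1,r},F)=k$. $\mathrm{Pois}(0)$ is the point mass at $0$. *)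

(* Defs.v *)
From HB Require Import structures.
From mathcomp Require Import all_boot all_order all_algebra.
From mathcomp Require Import all_classical all_reals all_analysis.
Set Implicit Arguments.
Unset Strict Implicit.
Unset Printing Implicit Defensive.
Import Order.TTheory GRing.Theory Num.Theory.
Import numFieldNormedType.Exports.

(* A simple graph with vertex type V, given by its set of edges; an edge is a
   two-element set of vertices. *)
Record sgraph (V : finType) := SGraph {
  edges : {set {set V}};
  edgesP : [forall e in edges, #|e| == 2] }.

HB.instance Definition _ V := [isSub for @edges V].
HB.instance Definition _ V := [Finite of sgraph V by <:].

Section Graphs.
Implicit Types U V : finType.

Definition adj V (G : sgraph V) (u v : V) : bool := [set u; v] \in edges G.

Definition degree V (G : sgraph V) (v : V) : nat := #|[set u | adj G v u]|.

Definition max_degree V (G : sgraph V) : nat := \max_(v : V) degree G v.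

(* The graph with vertex set W and edge set B, both inside the ambient type V,
   is isomorphic to H. *)
Definition iso_to U V (H : sgraph U) (W : {set V}) (B : {set {set V}}) : bool :=
  [exists f : {ffun U -> V}, [&& injectiveb f, f @: [set: U] == W
    & [set f @: (e : {set U}) | e in edges H] == B]].

Definition isog U V (H : sgraph U) (G : sgraph V) : bool :=
  iso_to H [set: V] (edges G).

Definition contains U V (H : sgraph U) (G : sgraph V) : bool :=
  [exists f : {ffun U -> V},
    injectiveb f && [forall e in edges H, f @: (e : {set U}) \in edges G]].

(* A subgraph is a pair of a vertex set and an edge set; that the edges join
   vertices of the vertex set follows from iso_to. *)
Definition num_subgraphs U V (H : sgraph U) (G : sgraph V) : nat :=
  #|[set S : {set V} * {set {set V}} |
      (S.2 \subset edges G) && iso_to H S.1 S.2]|.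

Definition num_induced U V (F : sgraph U) (G : sgraph V) : nat :=
  #|[set W : {set V} | iso_to F W [set e in edges G | e \subset W]]|.

Lemma iso_to_comp U U' V (H : sgraph U) (H' : sgraph U') (W : {set V}) B :
  isog H H' -> iso_to H' W B -> iso_to H W B.
Proof.
move=> /existsP[f /and3P[/injectiveP fI /eqP fT /eqP fE]].
move=> /existsP[h /and3P[/injectiveP hI /eqP <- /eqP <-]].
have comp (A : {set U}) : [ffun x => h (f x)] @: A = h @: (f @: A).
  by rewrite -imset_comp; apply: eq_imset => x; rewrite ffunE.
apply/existsP; exists [ffun x => h (f x)]; apply/and3P; split.
- by apply/injectiveP => x y; rewrite !ffunE => /hI /fI.
- by rewrite comp fT.
- by rewrite -fE -imset_comp; apply/eqP/eq_imset => e; rewrite comp.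
Qed.

Lemma isog_refl V (G : sgraph V) : isog G G.
Proof.
have idE (A : {set V}) : [ffun x : V => x] @: A = A.
  by rewrite -[RHS]imset_id; apply: eq_imset => x; rewrite ffunE.
apply/existsP; exists [ffun x => x]; apply/and3P; split.
- by apply/injectiveP => x y; rewrite !ffunE.
- by rewrite idE.
- by rewrite -[edges G in eqbRHS]imset_id; apply/eqP/eq_imset => e; rewrite idE.
Qed.

Lemma isog_sym U V (H : sgraph U) (G : sgraph V) : isog H G -> isog G H.
Proof.
move=> /existsP[f /and3P[/injectiveP fI /eqP fT /eqP fE]].
have fX y : {x | f x = y}.
  have /imsetP fy : y \in f @: [set: U] by rewrite fT inE.
  by apply: cid; have [x _ ->] := fy; exists x.
pose h : {ffun V -> U} := [ffun y => sval (fX y)].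
have hK : cancel h f by move=> y; rewrite ffunE; exact: (svalP (fX y)).
have fK : cancel f h by move=> x; apply: fI; rewrite hK.
have hE (A : {set U}) : h @: (f @: A) = A.
  by rewrite -imset_comp -[RHS]imset_id; apply: eq_imset.
apply/existsP; exists h; apply/and3P; split.
- exact/injectiveP/(can_inj hK).
- by rewrite -fT hE.
- rewrite -fE -imset_comp -[edges H in eqbRHS]imset_id.
  by apply/eqP/eq_imset => e; rewrite /= hE.
Qed.

Lemma isog_equivalence V : equivalence_rel (@isog V V).
Proof.
move=> F F' F''; split=> [|FF']; first exact: isog_refl.
apply/idP/idP; first exact/iso_to_comp/isog_sym.
exact: iso_to_comp.
Qed.

Lemma num_induced_isog U U' V (F : sgraph U) (F' : sgraph U') (G : sgraph V) :
  isog F F' -> num_induced F G = num_induced F' G.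
Proof.
move=> FF'; apply: eq_card => W; rewrite !inE; apply/idP/idP.
  exact/iso_to_comp/isog_sym.
exact: iso_to_comp.
Qed.

End Graphs.

Section Stars.
Variable r : nat.

Definition star_edges : {set {set 'I_r.+1}} :=
  [set [set ord0; lift ord0 i] | i : 'I_r].

Fact star_edgesP : [forall e in star_edges, #|e| == 2].
Proof. by apply/forall_inP => _ /imsetP[i _ ->]; rewrite cards2 neq_lift. Qed.

Definition star : sgraph 'I_r.+1 := SGraph star_edgesP.

Definition star_supergraphs (k : nat) : {set sgraph 'I_r.+1} :=
  [set F | contains star F & num_subgraphs star F == k].

(* One representative of each isomorphism class; isog_equivalence and
   num_induced_isog make the choice irrelevant. *)
Definition star_classes (k : nat) : {set sgraph 'I_r.+1} :=
  transversal (equivalence_partition (@isog 'I_r.+1 'I_r.+1)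
                 (star_supergraphs k))
              (star_supergraphs k).

(* The number of monochromatic r-stars in G under the coloring x. *)
Definition mono_stars (V : finType) (G : sgraph V) (x : V -> nat) : nat :=
  (\sum_(v : V) \sum_(U : {set V} | #|U| == r)
     (\prod_(u in U) adj G v u) * [forall u in U, x v == x u])%N.

(* The index k : 'I_r.+1 stands for the subscript k + 1. *)
Definition weighted_sum (z : 'I_r.+1 -> nat) : nat :=
  (\sum_(k < r.+1) k.+1 * z k)%N.

End Stars.

Local Open Scope classical_set_scope.
Local Open Scope ring_scope.

Section FiniteFamily.
Context d (Omega : measurableType d) (R : realType) (I : finType).
Variable (X : I -> {mfun Omega >-> nat}) (g : (I -> nat) -> nat).

Definition apply_family : Omega -> R := fun w => (g (fun i => X i w))%:R.

Fact measurable_apply_family : measurable_fun [set: Omega] apply_family.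
Proof.
move=> _ B mB; rewrite setTI.
rewrite (_ : apply_family @^-1` B =
    \bigcup_(f : {ffun I -> nat})
      [set w | B (g f)%:R /\ forall i, X i w = f i]); last first.
  apply/seteqP; split=> w /=.
    move=> Bw; exists [ffun i => X i w] => //=.
    split=> [|i]; last by rewrite ffunE.
    have -> // : [ffun i => X i w] = (fun i => X i w) :> (I -> nat).
    by apply/funext => i; rewrite ffunE.
  move=> [f _ [Bf Xf]]; rewrite /apply_family.
  by rewrite (_ : (fun i => X i w) = f)//; apply/funext.
apply: countable_bigcupT_measurable => [|f]; first exact: countableP.
have [Bf|Bf] := pselect (B (g f)%:R); last first.
  by rewrite (_ : [set w | _] = set0)//; apply/seteqP; split=> w // [].
rewrite (_ : [set w | _] = \bigcap_(i in [set: I]) X i @^-1` [set f i]).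
  apply: fin_bigcap_measurable => [|i _]; first exact: finite_finset.
  exact: measurable_funPTI.
by apply/seteqP; split=> [w [_ Xf] i _|w Xf]; [exact: Xf|split=> // i; exact: Xf].
Qed.

HB.instance Definition _ :=
  isMeasurableFun.Build _ _ _ _ apply_family measurable_apply_family.

End FiniteFamily.

Section Probability.
Context d (Omega : measurableType d) (R : realType) (P : probability Omega R).

Definition mutually_independent d' (T : measurableType d') (I : finType)
    (X : I -> {RV P >-> T}) : Prop :=
  forall (J : {set I}) (A : I -> set T), (forall i, measurable (A i)) ->
    P (\bigcap_(i in [set` J]) (X i @^-1` A i)) =
    (\prod_(i in J) P (X i @^-1` A i))%E.

Definition uniform_on_1_to (c : nat) (X : {RV P >-> nat}) : Prop :=
  forall i : nat, P (X @^-1` [set i]) =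
    (if (1 <= i <= c)%N then (c%:R^-1)%:E else 0%E).

(* The second argument of the library measure poisson_prob does not affect its
   value; for rate 0 the measure is the point mass at 0. *)
Definition poisson_distributed (rate : R) (Z : {RV P >-> nat}) : Prop :=
  forall A : set nat, distribution P Z A = poisson_prob rate 0%N A.

End Probability.

Definition cvg_in_distribution (R : realType)
    (d : nat -> measure_display) (Omega : forall n, measurableType (d n))
    (P : forall n, probability (Omega n) R) (X : forall n, {RV (P n) >-> R})
    (d' : measure_display) (Omega' : measurableType d')
    (Q : probability Omega' R) (Y : {RV Q >-> R}) : Prop :=
  forall x : R, {for x, continuous (cdf Y)} ->
    cdf (X n) x @[n --> \oo] --> cdf Y x.

(* Main.v *)
(** The number of monochromatic stars is T = sum_W a(W) I_W over the (r+1)-sets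
    W of vertices, where a(W) counts the vertices of W adjacent to all the
    others and I_W indicates that W is monochromatic.  Stein's identity for
    E[T 1{T = m}], with the sets meeting W as the dependency neighbourhood of
    I_W, shows that the probabilities p_m of T satisfy Panjer's recursion
    m p_m = sum_k k mu_k p_(m-k), where mu_k is the normalized number of W with
    a(W) = k, up to an error of order E[T] (Delta + 1) / c_n.  The law q of
    sum_k k Z_k satisfies the recursion with rates lambda_k exactly.

    (a) => (b): the recursion determines the limit of p_m / p_0, and tightness,
    which Markov's inequality provides, determines that of p_0.

    (b) => (a): a vertex of degree at least delta c_n has m neighbours of its
    own colour with probability at least (delta / 2)^m / (2 m!), which forces
    T >= 'C(m, r), at least of quadratic order in m; but Panjer's recursion
    gives q a tail of at most B^j / j! at (r+1) j.  Hence Delta = o(c_n).  The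
    recursion, read as a triangular system for the mu_k, then bounds E[T], and
    finally identifies the limit of each mu_k. *)
Require Import Defs.
From mathcomp Require Import all_boot all_order all_algebra.
From mathcomp Require Import perm ring lra zify.
Import Order.TTheory GRing.Theory Num.Theory.
Local Open Scope ring_scope.

Set Implicit Arguments.
Unset Strict Implicit.
Unset Printing Implicit Defensive.

Lemma finset_ind {T : finType} (P : {set T} -> Prop) :
  P set0 -> (forall x (A : {set T}), x \notin A -> P A -> P (x |: A)) ->
  forall A, P A.
Proof.
move=> P0 PU A; have [n] := ubnP #|A|; elim: n A => // n IH A.
have [->//|[x xA]] := set_0Vmem A.
rewrite (cardsD1 x) xA add1n ltnS => An.
by rewrite -(setD1K xA); apply: PU; [rewrite !inE eqxx|exact: IH].
Qed.

(** * Expectations over uniform colourings *)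

Section Resampling.
Context {R : realFieldType} {V : finType} {c : nat}.
Hypothesis c_gt0 : (0 < c)%N.
Implicit Types (x : {ffun V -> 'I_c}) (h : {ffun V -> 'I_c} -> R).

(** Colours are [0, ..., c - 1] and probabilities are normalized counts of colourings; the abstract
    sample space is linked to this model in [law_mono_stars]. *)
Definition expect h : R := (\sum_x h x) / c%:R ^+ #|V|.

Definition recolor x (u : V) (k : 'I_c) : {ffun V -> 'I_c} :=
  [ffun w => if w == u then k else x w].

(** Independence of [h] from the colour of [u], phrased as invariance under resampling that
    colour. *)
Definition free_of {T : Type} (h : {ffun V -> 'I_c} -> T) (u : V) : Prop :=
  forall x k, h (recolor x u k) = h x.

Lemma natc_neq0 : c%:R != 0 :> R.
Proof. by rewrite pnatr_eq0 -lt0n. Qed.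

Lemma expectD h h' : expect (fun x => h x + h' x) = expect h + expect h'.
Proof. by rewrite /expect big_split mulrDl. Qed.

Lemma expectB h h' : expect (fun x => h x - h' x) = expect h - expect h'.
Proof. by rewrite /expect big_split sumrN mulrBl. Qed.

Lemma expectZ a h : expect (fun x => a * h x) = a * expect h.
Proof. by rewrite /expect -mulr_sumr mulrA. Qed.

Lemma expect_sum (I : finType) (p : pred I) (h : I -> {ffun V -> 'I_c} -> R) :
  expect (fun x => \sum_(i | p i) h i x) = \sum_(i | p i) expect (h i).
Proof. by rewrite /expect exchange_big mulr_suml. Qed.

Lemma eq_expect h h' : (forall x, h x = h' x) -> expect h = expect h'.
Proof. by move=> hh; rewrite /expect (eq_bigr h'). Qed.

Lemma ler_expect h h' : (forall x, h x <= h' x) -> expect h <= expect h'.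
Proof.
by move=> hh; rewrite /expect ler_pM2r ?invr_gt0 ?exprn_gt0 ?ltr0n// ler_sum.
Qed.

Lemma expect_cst a : expect (fun=> a) = a.
Proof.
rewrite /expect sumr_const card_ffun card_ord -[a *+ _]mulr_natr natrX mulfK//.
by rewrite expf_neq0// natc_neq0.
Qed.

Lemma ler_norm_expect h : `|expect h| <= expect (fun x => `|h x|).
Proof.
rewrite /expect normrM [X in _ * X]ger0_norm ?invr_ge0 ?exprn_ge0//.
by rewrite ler_pM2r ?invr_gt0 ?exprn_gt0 ?ltr0n// ler_norm_sum.
Qed.

(** Given all other colours, that of [u] is uniform, so it hits the colour of [v] with probability
    [1 / c], whatever the value of [h]. *)
Lemma expect_eq u v h : u != v -> free_of h u ->
  expect (fun x => (x u == x v)%:R * h x) = c%:R^-1 * expect h.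
Proof.
move=> uv hu; rewrite /expect mulrA; congr (_ / _).
apply: (mulfI natc_neq0); rewrite mulrA divff ?natc_neq0// mul1r.
rewrite [RHS](partition_big (fun x => recolor x u (x v)) xpredT)//= mulr_sumr.
apply: eq_bigr => y _.
transitivity (\sum_(x | recolor x u (x v) == y) h y); last first.
  by apply: eq_bigr => x /eqP <-; rewrite hu.
(* The map giving u the colour of v is c-to-one onto the x with x u = x v. *)
pose S := [set x | recolor x u (x v) == y].
rewrite (eq_bigl [in S]); last by move=> x; rewrite inE.
rewrite sumr_const -[RHS]mulr_natl mulrA; congr (_ * _); rewrite -natrM.
have [yuv|yuv] := eqVneq (y u) (y v); last first.
  suff -> : S = set0 by rewrite cards0 muln0.
  apply/setP => x; rewrite !inE; apply: contra_neqF yuv => /eqP <-.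
  by rewrite !ffunE eqxx if_same.
suff -> : S = recolor y u @: setT.
  rewrite card_imset ?cardsT ?card_ord ?muln1//.
  by move=> k k' /ffunP/(_ u); rewrite !ffunE eqxx.
apply/setP => x; rewrite inE; apply/eqP/imsetP => [<-|[k _ ->]].
  by exists (x u) => //; apply/ffunP => w; rewrite !ffunE; case: eqP => // ->.
apply/ffunP => w; rewrite !ffunE [v == u]eq_sym (negbTE uv).
by case: eqP => // ->.
Qed.

Definition pair_prob (b : bool) : R := if b then c%:R^-1 else 1 - c%:R^-1.

Lemma expect_eqb (b : bool) u v h : u != v -> free_of h u ->
  expect (fun x => ((x u == x v) == b)%:R * h x) = pair_prob b * expect h.
Proof.
move=> uv hu; case: b.
  by rewrite -(@expect_eq u v)//; apply: eq_expect => x; rewrite eqb_id.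
rewrite /pair_prob mulrBl mul1r -(@expect_eq u v)// -expectB.
by apply: eq_expect => x; case: (x u == x v); rewrite ?mul1r ?mul0r ?subrr ?subr0.
Qed.

(** Vertices of [D] are peeled off one at a time: each differs from [v] and from the remaining ones,
    so resampling it leaves the other factors unchanged. The pattern [b] may also prescribe
    disagreements, as exact binomial probabilities require. *)
Lemma expect_prod_eqb (b : V -> bool) (D : {set V}) v h :
  v \notin D -> (forall u, u \in D -> free_of h u) ->
  expect (fun x => (\prod_(u in D) ((x u == x v) == b u)%:R) * h x) =
  (\prod_(u in D) pair_prob (b u)) * expect h.
Proof.
elim/(@finset_ind V): D h => [|u D uD IH] h.
  move=> _ _; rewrite big_set0 mul1r.
  by apply: eq_expect => x; rewrite big_set0 mul1r.
rewrite !inE negb_or => /andP[vu vD] hD.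
transitivity (expect (fun x => ((x u == x v) == b u)%:R *
    ((\prod_(w in D) ((x w == x v) == b w)%:R) * h x))).
  by apply: eq_expect => x; rewrite big_setU1//= mulrA.
rewrite expect_eqb ?big_setU1 1?eq_sym//=.
  by rewrite IH ?mulrA// => w wD; apply: hD; rewrite !inE wD orbT.
move=> x k; rewrite hD ?setU11//; congr (_ * _); apply: eq_bigr => w wD.
have wu : w != u by apply: contraNneq uD => <-.
by rewrite !ffunE (negbTE vu) (negbTE wu).
Qed.

End Resampling.
(** * Counting stars *)

Section StarCounts.
Context {V : finType}.
Implicit Types (G : sgraph V) (W : {set V}).

Definition centers G W : {set V} :=
  [set v in W | [forall u in W :\ v, adj G v u]].

Definition monochromatic {T : eqType} (x : V -> T) W : bool :=
  [forall u in W, forall w in W, x u == x w].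

Lemma adj_sym G u v : adj G u v = adj G v u.
Proof. by rewrite /adj setUC. Qed.

Lemma adj_irr G v : adj G v v = false.
Proof.
apply/negbTE/negP => /(forall_inP (edgesP G)).
by rewrite setUid cards1.
Qed.

Lemma centers_subset G W : centers G W \subset W.
Proof. by apply/subsetP => v; rewrite inE => /andP[]. Qed.

Lemma centersP G W v :
  reflect (v \in W /\ {in W, forall u, u != v -> adj G v u}) (v \in centers G W).
Proof.
rewrite inE; apply: (iffP andP) => -[vW av]; split => //.
  by move=> u uW uv; apply: (forall_inP av); rewrite !inE uv.
by apply/forall_inP => u; rewrite !inE => /andP[uv uW]; exact: av.
Qed.

Lemma monochromaticE {T : eqType} (x : V -> T) W v :
  v \in W -> monochromatic x W = [forall u in W :\ v, x v == x u].
Proof.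
move=> vW; apply/forall_inP/forall_inP => [xW u|xW u uW].
  rewrite !inE => /andP[_ uW]; exact: (forall_inP (xW v vW)).
have xE w : w \in W -> x w = x v.
  by move=> wW; have [->//|wv] := eqVneq w v; rewrite (eqP (xW w _))// !inE wv.
by apply/forall_inP => w wW; rewrite !xE.
Qed.

(** Anchoring at one vertex gives the product form that [expect_prod_eqb] evaluates. *)
Lemma monochromatic_prod {T : eqType} (x : V -> T) W v : v \in W ->
  (monochromatic x W = \prod_(u in W :\ v) (x u == x v) :> nat)%N.
Proof.
move=> vW; rewrite (monochromaticE _ vW).
have [/forall_inP xW|/forall_inPn[u uW xu]] := boolP [forall u in W :\ v, x v == x u].
  by rewrite big1// => u uW; rewrite eq_sym xW.
by rewrite (bigD1 u)//= eq_sym (negbTE xu).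
Qed.

(** A star with centre [v] and leaf set [U] is the same as the set [W = v |: U] with a marked
    centre; exchanging the sums counts each [W] once per centre. *)
Lemma mono_starsE r G (x : V -> nat) :
  mono_stars r G x =
  (\sum_(W : {set V} | #|W| == r.+1) #|centers G W| * monochromatic x W)%N.
Proof.
transitivity (\sum_(v : V) \sum_(W : {set V} | (#|W| == r.+1) && (v \in W))
    [forall u in W :\ v, adj G v u] * monochromatic x W)%N; last first.
  rewrite (exchange_big_dep (fun W : {set V} => #|W| == r.+1))/=; last first.
    by move=> v W _ /andP[].
  apply: eq_bigr => W Wr; rewrite -big_distrl/=; congr (_ * _)%N.
  rewrite -[#|centers G W|]sum1_card /centers.
  rewrite [RHS](eq_bigl
    (fun v => (v \in W) && [forall u in W :\ v, adj G v u])).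
    rewrite [RHS]big_mkcondr/= Wr; apply: eq_bigr => v _.
    by case: [forall u in W :\ v, _].
  by move=> v; rewrite inE.
rewrite /mono_stars; apply: eq_bigr => v _.
(* Leaf sets containing [v] contribute nothing, as no vertex is adjacent to itself. *)
rewrite (bigID (fun U : {set V} => v \in U))/= big1 ?add0n; last first.
  by move=> U /andP[_ vU]; rewrite (bigD1 v)//= adj_irr.
rewrite (reindex_onto (fun W => W :\ v) (fun U => v |: U))/=; last first.
  by move=> U /andP[_ vU]; rewrite setU1K.
apply: eq_big => [W|W /andP[_ /eqP WE]]; last first.
  have vW : v \in W by rewrite -WE setU11.
  rewrite -(monochromaticE _ vW); congr (_ * _)%N.
  have [/forall_inP aW|/forall_inPn[u uW au]] := boolP [forall u in W :\ v, adj G v u].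
    by rewrite big1// => u uW; rewrite aW.
  by rewrite (bigD1 u)//= (negbTE au).
rewrite setD11 andbT; have [vW|vW] := boolP (v \in W).
  by rewrite setD1K// eqxx (cardsD1 v W) vW.
rewrite andbF; apply/negbTE/negP => /andP[_ /eqP WE].
by rewrite -WE setU11 in vW.
Qed.

End StarCounts.

Lemma leq_expn2r m n e : (m <= n -> m ^ e <= n ^ e)%N.
Proof. by move=> mn; elim: e => // e IH; rewrite !expnS leq_mul. Qed.

Lemma leq_bin_exp n m : ('C(n, m) <= n ^ m)%N.
Proof.
apply: (@leq_trans (n ^_ m)%N); first by rewrite -bin_ffact leq_pmulr// fact_gt0.
by elim: m => // m IH; rewrite ffactnSr expnSr leq_mul// leq_subr.
Qed.

Lemma leq_card_bigcup (I T : finType) (p : pred I) (F : I -> {set T}) (k : nat) :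
  (forall i, p i -> #|F i| <= k)%N ->
  (#|\bigcup_(i | p i) F i| <= #|p| * k)%N.
Proof.
move=> Fk; rewrite -sum_nat_const.
apply: (@leq_trans (\sum_(i | p i) #|F i|)%N); last exact: leq_sum.
elim/big_rec2: _ => [|i n A _ An]; first by rewrite cards0.
exact: leq_trans (leq_card_setU _ _) (leq_add (leqnn _) An).
Qed.

(** * Stars meeting a given vertex set *)

Section NearStars.
Context {V : finType} (r : nat) (G : sgraph V).
Implicit Types (W B : {set V}).

Definition star_sets : {set {set V}} :=
  [set W : {set V} | (#|W| == r.+1) && (centers G W != set0)].

(** Such a set is coded by a part [A] of [W], with [2 ^ r.+1] choices, and by [i] neighbours of [v];
    the fixed part [E] will be empty or the centre itself. *)
Lemma card_star_extensions (W : {set V}) (i : nat) (E : {set V}) v :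
  #|W| = r.+1 ->
  (#|\bigcup_(A in powerset W) [set A :|: (E :|: D) | D in
      [set D : {set V} | D \subset [set u | adj G v u] & #|D| == i]]|
    <= 2 ^ r.+1 * max_degree G ^ i)%N.
Proof.
move=> Wr; rewrite -Wr -card_powerset; apply: leq_card_bigcup => A _.
apply: leq_trans (leq_imset_card _ _) _.
rewrite cards_draws (leq_trans (leq_bin_exp _ _))// leq_expn2r//.
exact: (leq_bigmax v).
Qed.

(* The centre of such a star B lies in W or is adjacent to a vertex of W; the
   rest of B outside W consists of neighbours of the centre. *)
Lemma card_near_stars (W : {set V}) (i : nat) : #|W| = r.+1 ->
  (#|[set B in star_sets | (B :&: W != set0) && (#|B :\: W| == i.+1)]| <=
   2 * (r.+1 * 2 ^ r.+1) * max_degree G ^ i.+1)%N.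
Proof.
move=> Wr.
pose ext E v j := \bigcup_(A in powerset W) [set A :|: (E :|: D) | D in
      [set D : {set V} | D \subset [set u | adj G v u] & #|D| == j]].
pose N1 := \bigcup_(v in W) ext set0 v i.+1.
(* Here the centre is one of the [i.+1] vertices outside [W]: as a neighbour of [u] it costs one
   factor of the maximum degree, which leaves [i] further neighbours. *)
pose N2 := \bigcup_(u in W) \bigcup_(v in [set v | adj G u v]) ext [set v] v i.
have N1_le : (#|N1| <= r.+1 * (2 ^ r.+1 * max_degree G ^ i.+1))%N.
  by rewrite -{1}Wr leq_card_bigcup// => v _; exact: card_star_extensions.
have N2_le : (#|N2| <= r.+1 * (2 ^ r.+1 * max_degree G ^ i.+1))%N.
  rewrite -{1}Wr leq_card_bigcup// => u _; rewrite [(max_degree G ^ _)%N]expnS mulnCA.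
  apply: (@leq_trans (#|[set v | adj G u v]| * (2 ^ r.+1 * max_degree G ^ i))%N).
    by apply: leq_card_bigcup => v _; exact: card_star_extensions.
  by rewrite leq_mul2r (leq_bigmax u) orbT.
rewrite mul2n -addnn mulnDl -mulnA; apply: leq_trans (leq_add N1_le N2_le).
apply: leq_trans (leq_card_setU _ _); apply/subset_leq_card/subsetP => B.
rewrite !inE => /and3P[/andP[/eqP Br /set0Pn[v]]].
rewrite inE => /andP[vB /forall_inP av] /set0Pn[u].
rewrite inE => /andP[uB uW] /eqP Bi.
have [vW|vW] := boolP (v \in W); apply/orP; [left|right].
  apply/bigcupP; exists v => //; apply/bigcupP; exists (B :&: W).
    by rewrite inE subsetIr.
  apply/imsetP; exists (B :\: W); last by rewrite set0U setID.
  rewrite inE Bi eqxx andbT; apply/subsetP => w; rewrite !inE => /andP[wW wB].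
  by apply: av; rewrite !inE wB andbT; apply: contraNneq wW => ->.
apply/bigcupP; exists u => //; apply/bigcupP; exists v.
  rewrite inE adj_sym; apply: av; rewrite !inE uB andbT.
  by apply: contraNneq vW => <-.
apply/bigcupP; exists (B :&: W); first by rewrite inE subsetIr.
have vBW : v \in B :\: W by rewrite inE vW.
apply/imsetP; exists (B :\: W :\ v); last by rewrite setD1K// setID.
rewrite inE; apply/andP; split; last first.
  by move: Bi; rewrite (cardsD1 v) vBW add1n => -[->].
apply/subsetP => w; rewrite !inE => /and3P[wv _ wB].
by apply: av; rewrite !inE wv.
Qed.

End NearStars.

(** * Stein's identity for the number of monochromatic stars *)

(* Sums the bound of card_near_stars over the r possible sizes of B :\: W. *)
Definition near_const (r : nat) : nat := (r * (2 * (r.+1 * 2 ^ r.+1)))%N.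

Section SteinEquation.
Context {R : realFieldType} {V : finType} {c r : nat} (G : sgraph V).
Hypothesis c_gt0 : (0 < c)%N.
Implicit Types (x : {ffun V -> 'I_c}) (h : {ffun V -> 'I_c} -> R).
Implicit Types (W B : {set V}).

Let q : R := c%:R^-1.

Let q_ge0 : 0 <= q. Proof. by rewrite invr_ge0. Qed.

Let q_le1 : q <= 1.
Proof. by rewrite invf_le1 ?ltr0n// ler1n. Qed.

Lemma recolor_notin W x u k : u \notin W ->
  monochromatic (recolor x u k) W = monochromatic x W.
Proof.
move=> uW; have xE w : w \in W -> recolor x u k w = x w.
  by move=> wW; rewrite ffunE (negbTE (_ : w != u))//; apply: contraNneq uW => <-.
apply/forall_inP/forall_inP => xW w wW; apply/forall_inP => w' wW'.
  by rewrite -!xE//; exact: (forall_inP (xW w wW)).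
by rewrite !xE//; exact: (forall_inP (xW w wW)).
Qed.

Lemma expect_monochromatic W h : #|W| = r.+1 ->
  (forall u, u \in W -> free_of h u) ->
  expect (fun x => (monochromatic x W)%:R * h x) = q ^+ r * expect h.
Proof.
move=> Wr hW; have [W0|[v vW]] := set_0Vmem W.
  by rewrite W0 cards0 in Wr.
transitivity (expect (fun x =>
    (\prod_(u in W :\ v) ((x u == x v) == true)%:R) * h x)).
  apply: eq_expect => x; rewrite (monochromatic_prod _ vW) natr_prod.
  by congr (_ * _); apply: eq_bigr => u _; rewrite eqb_id.
rewrite (@expect_prod_eqb _ _ _ _ (fun=> true))// ?setD11//.
  rewrite prodr_const; congr (_ ^+ _ * _).
  by move: Wr; rewrite (cardsD1 v) vW add1n => -[].
by move=> u; rewrite inE => /andP[_ /hW].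
Qed.

(** With a common vertex [v] as anchor, each vertex of [B :\: W] must agree with [v], independently
    of [W] being monochromatic; the conditions on the rest of [B] are bounded by 1. *)
Lemma expect_monochromatic2 W B : #|W| = r.+1 -> B :&: W != set0 ->
  expect (fun x => (monochromatic x W)%:R * (monochromatic x B)%:R) <=
  q ^+ r * q ^+ #|B :\: W|.
Proof.
move=> Wr /set0Pn[v]; rewrite inE => /andP[vB vW].
have -> : q ^+ r * q ^+ #|B :\: W| = expect (fun x =>
    (\prod_(u in B :\: W) ((x u == x v) == true)%:R) *
    ((monochromatic x W)%:R * 1)).
  rewrite (@expect_prod_eqb _ _ _ _ (fun=> true))//.
  - rewrite expect_monochromatic// expect_cst// mulr1 mulrC.
    by rewrite prodr_const.
  - by rewrite inE vW.
  - by move=> u; rewrite inE => /andP[uW _] x k; rewrite recolor_notin.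
apply: ler_expect => // x; rewrite mulr1 mulrC ler_wpM2r// (monochromatic_prod _ vB).
rewrite natr_prod [leLHS](bigID (fun u => u \in W))/=.
rewrite [leRHS](eq_bigl (fun u => (u \in B :\ v) && (u \notin W))); last first.
  move=> u; rewrite !inE; case: eqVneq => [->|]; first by rewrite vW.
  by rewrite andbC.
under [leRHS]eq_bigr do rewrite eqb_id.
rewrite ler_piMl//; first by apply: prodr_ge0.
by apply: prodr_ile1 => u _; case: (x u == x v); rewrite /= ?ler01 ?lexx.
Qed.

Definition near W : {set {set V}} :=
  [set B in star_sets r G | (B :&: W != set0) && (B != W)].

(** The sets are sorted by [i.+1 = #|B :\: W|], which lies between 1 and [r]. In each class their
    number is of order [D ^ i.+1] and their weight is [c ^ - i.+1]; since [D <= c], the product is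
    at most of order [D / c]. *)
Lemma near_weight W : #|W| = r.+1 -> (max_degree G <= c)%N ->
  \sum_(B in near W) q ^+ #|B :\: W| <=
  (near_const r)%:R * ((max_degree G)%:R * q).
Proof.
move=> Wr Dc; pose D := max_degree G.
have qD : D%:R * q <= 1 by rewrite ler_pdivrMr ?ltr0n// mul1r ler_nat.
apply: (@le_trans _ _ (\sum_(B in near W) \sum_(i < r)
    (#|B :\: W| == i.+1)%:R * q ^+ i.+1)).
  apply: ler_sum => B; rewrite !inE => /and3P[/andP[/eqP Br _] /set0Pn[v]].
  rewrite inE => /andP[vB vW] BW.
  have Bp : (0 < #|B :\: W|)%N.
    rewrite card_gt0 setD_eq0; apply: contra BW => BW.
    by rewrite eqEcard BW Br Wr leqnn.
  have Blt : (#|B :\: W|.-1 < r)%N.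
    rewrite -ltnS prednK// -Br (cardsD1 v B) vB add1n ltnS subset_leq_card//.
    apply/subsetP => u; rewrite !inE => /andP[uW ->].
    by rewrite andbT; apply: contraNneq uW => ->.
  rewrite (bigD1 (Ordinal Blt))//= prednK// eqxx mul1r lerDl sumr_ge0// => i _.
  by rewrite mulr_ge0// exprn_ge0.
rewrite exchange_big/= /near_const natrM -mulrA.
apply: (@le_trans _ _ (\sum_(i < r) (2 * (r.+1 * 2 ^ r.+1))%N%:R * (D%:R * q))); last first.
  by rewrite sumr_const card_ord -[leLHS]mulr_natl.
apply: ler_sum => i _; rewrite -mulr_suml -natr_sum.
have -> : (\sum_(B in near W) (#|B :\: W| == i.+1))%N =
    #|[set B in near W | #|B :\: W| == i.+1]|.
  rewrite -sum1dep_card big_mkcondr/=; apply: eq_bigr => B _.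
  by case: (_ == _).
apply: (@le_trans _ _ ((2 * (r.+1 * 2 ^ r.+1) * D ^ i.+1)%N%:R * q ^+ i.+1)).
  rewrite ler_wpM2r ?exprn_ge0// ler_nat.
  apply: leq_trans (card_near_stars G i Wr).
  apply/subset_leq_card/subsetP => B; rewrite !inE.
  by move=> /andP[/and3P[-> -> _] ->].
rewrite natrM natrX -mulrA -exprMn ler_wpM2l// exprS ler_piMr//.
  by rewrite mulr_ge0.
by rewrite exprn_ile1// mulr_ge0.
Qed.

Definition star_count x : nat :=
  (\sum_(W in star_sets r G) #|centers G W| * monochromatic x W)%N.

Definition count_prob (m : nat) : R := expect (fun x => (star_count x == m)%:R).

Definition count_mean : R :=
  \sum_(W in star_sets r G) #|centers G W|%:R * q ^+ r.

Let far W x : nat := (\sum_(B in star_sets r G | B :&: W == set0)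
  #|centers G B| * monochromatic x B)%N.

(** Unweighted, as it serves only to bound the indicator that some near set is monochromatic. *)
Let nearby W x : nat := (\sum_(B in near W) monochromatic x B)%N.

Lemma star_count_split W x : W \in star_sets r G -> nearby W x = 0%N ->
  star_count x = (#|centers G W| * monochromatic x W + far W x)%N.
Proof.
move=> WS /eqP; rewrite sum_nat_eq0 => /forall_inP xW.
rewrite /star_count (bigID (fun B => B :&: W == set0))/= addnC; congr (_ + _)%N.
rewrite (bigD1 W)/=; last first.
  rewrite WS setIid; move: WS; rewrite inE => /andP[/eqP Wr _].
  by rewrite -cards_eq0 Wr.
rewrite big1 ?addn0// => B /andP[/andP[BS BW] BW'].
by rewrite (eqP (xW B _)) ?muln0// inE BS BW.
Qed.

Lemma normr_boolB (b b' : bool) : `|b%:R - b'%:R| <= 1 :> R.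
Proof.
by case: b; case: b'; rewrite /= ?subrr ?subr0 ?sub0r ?normrN ?normr1 ?normr0.
Qed.

(** If [W] is monochromatic and no near set is, the count equals the far count plus the contribution
    of [W]; otherwise the indicators differ by at most 1. *)
Lemma count_near_far W m x : W \in star_sets r G ->
  `|(monochromatic x W)%:R * (star_count x == m)%:R -
    (monochromatic x W)%:R * (far W x + #|centers G W| == m)%N%:R| <=
  \sum_(B in near W) (monochromatic x W)%:R * (monochromatic x B)%:R :> R.
Proof.
move=> WS; rewrite -mulr_sumr -natr_sum -mulrBr normrM ger0_norm//.
have [n0|n0] := posnP (nearby W x); last first.
  by rewrite ler_wpM2l// (le_trans (normr_boolB _ _))// ler1n.
rewrite (star_count_split WS n0) -/(nearby W x) n0 mulr0.
case: (monochromatic x W); last by rewrite mul0r.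
by rewrite muln1 addnC subrr normr0 mulr0.
Qed.

(** The far count and the full count coincide unless [W] or a near set is monochromatic. *)
Lemma far_count W m x : W \in star_sets r G ->
  `|(far W x + #|centers G W| == m)%N%:R -
    (star_count x + #|centers G W| == m)%N%:R| <=
  (monochromatic x W)%:R + \sum_(B in near W) (monochromatic x B)%:R :> R.
Proof.
move=> WS; rewrite -natr_sum -natrD.
have [n0|n0] := posnP (monochromatic x W + nearby W x)%N; last first.
  by rewrite (le_trans (normr_boolB _ _))// ler1n.
move: n0 => /eqP; rewrite addn_eq0 => /andP[/eqP x0 /eqP n0].
by rewrite (star_count_split WS n0) x0 muln0 add0n subrr normr0.
Qed.

(** The far count is substituted for the full one and then undone. The first move costs the
    probability that [W] and a near set are both monochromatic, the second [q ^+ r] times the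
    probability that [W] or a near set is. *)
Lemma stein_term W m : W \in star_sets r G -> (0 < r)%N ->
  (max_degree G <= c)%N ->
  `|expect (fun x => (monochromatic x W)%:R * (star_count x == m)%:R) -
    q ^+ r * expect (fun x => (star_count x + #|centers G W| == m)%N%:R)| <=
  q ^+ r * ((2 * near_const r * max_degree G).+1%N%:R * q).
Proof.
move=> WS r0 Dc; have Wr : #|W| = r.+1 by move: WS; rewrite inE => /andP[/eqP].
have Bcard B : B \in near W -> #|B| = r.+1.
  by rewrite !inE => /andP[/andP[/eqP]].
have BW B : B \in near W -> B :&: W != set0 by rewrite !inE => /and3P[].
have expectI B : #|B| = r.+1 -> expect (fun x => (monochromatic x B)%:R) = q ^+ r.
  move=> Br; have := @expect_monochromatic B (fun=> 1) Br.
  rewrite expect_cst// mulr1 => <-//.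
  by apply: eq_expect => x; rewrite mulr1.
have near_le := near_weight Wr Dc.
set E1 := expect _; set E3 := expect _.
(* In E2 the colours inside W no longer matter: the count over sets disjoint
   from W is independent of I_W. *)
pose E2 := expect (fun x => (far W x + #|centers G W| == m)%N%:R) : R.
have -> : E1 - q ^+ r * E3 = (E1 - q ^+ r * E2) + q ^+ r * (E2 - E3) by ring.
apply: le_trans (ler_normD _ _) _.
have -> : q ^+ r * ((2 * near_const r * max_degree G).+1%N%:R * q) =
    q ^+ r * ((near_const r)%:R * ((max_degree G)%:R * q)) +
    q ^+ r * (q + (near_const r)%:R * ((max_degree G)%:R * q)).
  by rewrite -natr1 !natrM; ring.
apply: lerD.
  rewrite /E2 -(expect_monochromatic Wr); last first.
    move=> u uW x k; congr (_ == _)%:R; congr (_ + _)%N.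
    apply: eq_bigr => B /andP[_ /eqP BW0]; rewrite recolor_notin//.
    by apply/negP => uB; move/setP: BW0 => /(_ u); rewrite !inE uB uW.
  rewrite -expectB (le_trans (ler_norm_expect c_gt0 _))//.
  apply: (@le_trans _ _ (\sum_(B in near W) q ^+ r * q ^+ #|B :\: W|)).
    apply: le_trans (ler_expect c_gt0 (fun x => count_near_far m x WS)) _.
    rewrite expect_sum; apply: ler_sum => B Bn.
    exact: expect_monochromatic2 (BW _ Bn).
  by rewrite -mulr_sumr ler_wpM2l// exprn_ge0.
rewrite normrM ger0_norm ?exprn_ge0// ler_wpM2l ?exprn_ge0// -expectB.
rewrite (le_trans (ler_norm_expect c_gt0 _))//.
apply: le_trans (ler_expect c_gt0 (fun x => far_count m x WS)) _.
rewrite expectD expectI// expect_sum; apply: lerD.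
  by rewrite -[leRHS]expr1 ler_wiXn2l.
(* Since [B] meets [W], [#|B :\: W| <= r], so [near_weight] also controls the sum of the single
   probabilities [q ^+ r]. *)
apply: le_trans near_le; apply: ler_sum => B Bn; rewrite (expectI _ (Bcard _ Bn)).
rewrite ler_wiXn2l// -ltnS -(Bcard _ Bn).
have /set0Pn[v] := BW _ Bn; rewrite inE => /andP[vB vW].
rewrite (cardsD1 v B) vB add1n ltnS subset_leq_card//.
apply/subsetP => u; rewrite !inE => /andP[uW ->].
by rewrite andbT; apply: contraNneq uW => ->.
Qed.

(** On the event that the count is [m], the factor [m] may be replaced by the sum of
    [#|centers G W|] over monochromatic [W]; [stein_term] then applies to each [W]. *)
Lemma stein_equation m : (0 < r)%N -> (max_degree G <= c)%N ->
  `|m%:R * count_prob m - \sum_(W in star_sets r G) #|centers G W|%:R * q ^+ r *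
     expect (fun x => (star_count x + #|centers G W| == m)%N%:R)| <=
  count_mean * ((2 * near_const r * max_degree G).+1%N%:R * q).
Proof.
move=> r0 Dc.
have -> : m%:R * count_prob m = \sum_(W in star_sets r G) #|centers G W|%:R *
    expect (fun x => (monochromatic x W)%:R * (star_count x == m)%:R).
  rewrite /count_prob -expectZ.
  transitivity (expect (fun x => \sum_(W in star_sets r G) #|centers G W|%:R *
      ((monochromatic x W)%:R * (star_count x == m)%:R) : R)).
    apply: eq_expect => x.
    transitivity ((star_count x)%:R * (star_count x == m)%:R : R).
      by case: eqP => [->|]; rewrite ?mulr0.
    rewrite {1}/star_count natr_sum mulr_suml.
    by apply: eq_bigr => W _; rewrite natrM mulrA.
  by rewrite expect_sum; apply: eq_bigr => W _; rewrite expectZ.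
rewrite -sumrB /count_mean mulr_suml (le_trans (ler_norm_sum _ _ _))//.
apply: ler_sum => W WS; rewrite -!mulrA -mulrBr normrM ger0_norm// ler_wpM2l//.
exact: stein_term.
Qed.

(** * The approximate recursion in terms of star densities *)

Lemma star_setsE (F : {set V} -> nat) :
  (\sum_(W : {set V} | #|W| == r.+1) #|centers G W| * F W =
   \sum_(W in star_sets r G) #|centers G W| * F W)%N.
Proof.
rewrite (bigID (fun W => centers G W != set0))/= [X in (_ + X)%N]big1 ?addn0.
  by apply: eq_bigl => W; rewrite inE.
by move=> W /andP[_ /negPn/eqP ->]; rewrite cards0.
Qed.

Lemma mono_stars_count x :
  mono_stars r G (fun v => (x v).+1) = star_count x.
Proof.
rewrite mono_starsE (star_setsE (fun W => monochromatic (fun v => (x v).+1) W)).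
apply: eq_bigr => W _; congr (_ * _)%N.
Qed.

(* As in star_classes, the index k stands for the subscript k + 1. *)
Definition star_density (k : nat) : R := q ^+ r *
  #|[set W : {set V} | (#|W| == r.+1) && (#|centers G W| == k.+1)]|%:R.

Lemma sum_star_sets (F : nat -> R) :
  \sum_(W in star_sets r G) #|centers G W|%:R * q ^+ r * F #|centers G W| =
  \sum_(k < r.+1) k.+1%:R * star_density k * F k.+1.
Proof.
have centers_lt W : W \in star_sets r G -> (#|centers G W|.-1 < r.+1)%N.
  rewrite inE => /andP[/eqP <- W0]; rewrite prednK ?card_gt0//.
  exact: subset_leq_card (centers_subset G W).
rewrite (partition_big (fun W => inord #|centers G W|.-1 : 'I_r.+1) xpredT)//=.
apply: eq_bigr => k _; rewrite /star_density.
rewrite (eq_bigr (fun=> k.+1%:R * q ^+ r * F k.+1)); last first.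
  move=> W /andP[WS /eqP <-]; rewrite inordK ?centers_lt//.
  by rewrite prednK// card_gt0; move: WS; rewrite inE => /andP[].
rewrite (eq_bigl [in [set W : {set V} | (#|W| == r.+1) && (#|centers G W| == k.+1)]]).
  by rewrite sumr_const -[LHS]mulr_natr; ring.
move=> W; rewrite inE; have [/eqP Wk|Wk] := boolP (#|centers G W| == k.+1).
  rewrite Wk/= inord_val eqxx andbT.
  by rewrite inE -card_gt0 Wk andbT.
rewrite andbF; apply/negbTE; apply: contra Wk => /andP[WS /eqP kE].
rewrite -kE inordK ?centers_lt// prednK// card_gt0.
by move: WS; rewrite inE => /andP[].
Qed.

Lemma count_meanE : count_mean = \sum_(k < r.+1) k.+1%:R * star_density k.
Proof.
rewrite /count_mean; under eq_bigr do rewrite -[_ * _]mulr1.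
by rewrite (sum_star_sets (fun=> 1)); under eq_bigr do rewrite mulr1.
Qed.

Lemma star_density_ge0 k : 0 <= star_density k.
Proof. by rewrite mulr_ge0// exprn_ge0. Qed.

(** Stein's equation with the sets grouped by their number [j] of centres: each contributes the
    probability that the count is [m - j], which is 0 when [j > m]. *)
Lemma panjer_approx m : (0 < r)%N -> (max_degree G <= c)%N ->
  `|m%:R * count_prob m - \sum_(k < r.+1) k.+1%:R * star_density k *
     (if (k < m)%N then count_prob (m - k.+1)%N else 0)| <=
  count_mean * ((2 * near_const r * max_degree G).+1%N%:R * q).
Proof.
move=> r0 Dc.
rewrite -(sum_star_sets (fun j => if (j <= m)%N then count_prob (m - j)%N else 0)).
apply: le_trans (stein_equation m r0 Dc).
rewrite le_eqVlt; apply/orP; left; apply/eqP; congr `|_ - _|.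
apply: eq_bigr => W _; congr (_ * _); case: ifPn => [jm|].
  by apply: eq_expect => x; rewrite -(eqn_add2r #|centers G W|) subnK.
rewrite -ltnNge => jm; rewrite -(expect_cst (V := V) c_gt0 (0 : R)); apply: eq_expect => x.
by rewrite gtn_eqF// (leq_trans jm)// leq_addl.
Qed.

(** * Upper and lower tail bounds for the star count *)

Lemma expect_star_count : expect (fun x => (star_count x)%:R : R) = count_mean.
Proof.
rewrite /count_mean (@eq_expect _ _ _ _ (fun x => \sum_(W in star_sets r G)
    #|centers G W|%:R * ((monochromatic x W)%:R * 1))); last first.
  by move=> x; rewrite natr_sum; apply: eq_bigr => W _; rewrite natrM mulr1.
rewrite expect_sum; apply: eq_bigr => W; rewrite inE => /andP[/eqP Wr _].
by rewrite expectZ expect_monochromatic// expect_cst// mulr1.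
Qed.

Lemma sum_eqn_lt (n M : nat) : \sum_(j < M) (n == j)%:R = (n < M)%N%:R :> R.
Proof.
have [nM|nM] := ltnP n M; last first.
  by rewrite big1// => j _; rewrite gtn_eqF// (leq_trans (ltn_ord j)).
rewrite (bigD1 (Ordinal nM))//= eqxx big1 ?addr0// => j /eqP jn.
by case: eqP => // nj; case: jn; apply: val_inj.
Qed.

(** Tails are kept as one minus a finite sum of point probabilities, a form that passes to the limit
    termwise. *)
Lemma count_tailE M : 1 - \sum_(j < M) count_prob j =
  expect (fun x => (M <= star_count x)%N%:R).
Proof.
rewrite -expect_sum -{1}(expect_cst (V := V) c_gt0 (1 : R)) -expectB.
by apply: eq_expect => x; rewrite sum_eqn_lt; case: ltnP => _; rewrite /= ?subrr ?subr0.
Qed.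

Lemma count_tail_ge0 M : 0 <= 1 - \sum_(j < M) count_prob j.
Proof.
by rewrite count_tailE -(expect_cst (V := V) c_gt0 (0 : R)); apply: ler_expect.
Qed.

Lemma count_markov M : M%:R * (1 - \sum_(j < M) count_prob j) <= count_mean.
Proof.
rewrite count_tailE -expectZ -expect_star_count; apply: ler_expect => // x.
by case: leqP => Mx; rewrite /= ?mulr1 ?mulr0 ?ler0n ?ler_nat.
Qed.

Lemma bin_leq_star_count x v (A : {set V}) :
  {in A, forall u, adj G v u /\ x u = x v} -> ('C(#|A|, r) <= star_count x)%N.
Proof.
move=> vA; rewrite -mono_stars_count /mono_stars (bigD1 v)//=.
rewrite (leq_trans _ (leq_addr _ _))// -cards_draws -sum1dep_card.
rewrite [leqRHS](bigID (fun U : {set V} => U \subset A))/=.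
rewrite (leq_trans _ (leq_addr _ _))//.
rewrite (eq_bigl (fun U : {set V} => (#|U| == r) && (U \subset A))); last first.
  by move=> U; rewrite andbC.
apply: leq_sum => U /andP[_ /subsetP UA].
rewrite big1 ?mul1n; last by move=> u /UA/vA[->].
by rewrite lt0b; apply/forall_inP => u /UA/vA[_ ->].
Qed.

(** The left side is the binomial probability that exactly [m] vertices of [D] share the colour of
    [v], and on that event their [r]-subsets already give ['C(m, r)] monochromatic stars. *)
Lemma count_tail_lower v (D : {set V}) m M :
  D \subset [set u | adj G v u] -> (M <= 'C(m, r))%N ->
  'C(#|D|, m)%:R * (q ^+ m * (1 - q) ^+ (#|D| - m)) <=
  1 - \sum_(j < M) count_prob j.
Proof.
move=> /subsetP Dv Mm; rewrite count_tailE -cards_draws.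
pose S := [set A : {set V} | A \subset D & #|A| == m].
have vD : v \notin D by apply/negP => /Dv; rewrite inE adj_irr.
have -> : #|S|%:R * (q ^+ m * (1 - q) ^+ (#|D| - m)) =
    expect (fun x => \sum_(A in S)
      (\prod_(u in D) ((x u == x v) == (u \in A))%:R) * 1).
  rewrite expect_sum mulr_natl -sumr_const; apply: eq_bigr => A.
  rewrite inE => /andP[AD /eqP Am].
  rewrite (@expect_prod_eqb _ _ _ _ (fun u => u \in A))// expect_cst// mulr1.
  rewrite (bigID (fun u => u \in A))/=; congr (_ * _).
    rewrite (eq_bigr (fun=> q)); last by move=> u /andP[_ uA]; rewrite /pair_prob uA.
    rewrite (eq_bigl [in A]) ?prodr_const ?Am// => u.
    by rewrite andb_idl// => /(subsetP AD).
  rewrite (eq_bigr (fun=> 1 - q)); last first.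
    by move=> u /andP[_ uA]; rewrite /pair_prob (negbTE uA).
  rewrite (eq_bigl [in D :\: A]) ?prodr_const; last by move=> u; rewrite inE andbC.
  by rewrite cardsD (setIidPr AD) Am.
apply: ler_expect => // x; pose A0 := [set u in D | x u == x v].
(* Each product is the indicator that [A] is exactly the set of vertices of [D] coloured like [v],
   so at most one of them is nonzero. *)
have prodE A : A \in S ->
    (\prod_(u in D) ((x u == x v) == (u \in A))%:R) * 1 = (A == A0)%:R :> R.
  rewrite inE mulr1 => /andP[AD _]; have [->|] := eqVneq A A0.
    by rewrite big1// => u uD; rewrite inE uD eqxx.
  rewrite eqEsubset negb_and => /orP[]/subsetPn[u].
    move=> uA; have uD := subsetP AD u uA.
    by rewrite inE uD/= => xu; rewrite (bigD1 u)//= uA (negbTE xu) mul0r.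
  rewrite inE => /andP[uD xu] uA.
  by rewrite (bigD1 u)//= xu (negbTE uA) mul0r.
rewrite (eq_bigr _ prodE); have [A0S|A0S] := boolP (A0 \in S); last first.
  rewrite big1 ?ler0n// => A AS; case: eqP => // AA0.
  by rewrite -AA0 AS in A0S.
rewrite (bigD1 A0)//= eqxx big1 ?addr0; last by move=> A /andP[_ /negbTE ->].
suff -> : (M <= star_count x)%N by [].
apply: leq_trans Mm _; move: A0S; rewrite inE => /andP[_ /eqP <-].
apply: (@bin_leq_star_count _ v) => u; rewrite inE => /andP[/Dv + /eqP ->].
by rewrite inE.
Qed.

(** The neighbourhood of a vertex of degree at least [e] is thinned to exactly [e] vertices, so that
    [e] can later be tuned to a small multiple of [c]. *)
Lemma count_tail_max_degree e m M : (0 < e)%N -> (e <= max_degree G)%N ->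
  (M <= 'C(m, r))%N ->
  'C(e, m)%:R * (q ^+ m * (1 - q) ^+ (e - m)) <= 1 - \sum_(j < M) count_prob j.
Proof.
move=> e0 eD Mm; case: (pickP (fun v => e <= degree G v)%N) => [v ev|no_v].
  pose N := [set u | adj G v u].
  have : (0 < #|[set D : {set V} | D \subset N & #|D| == e]|)%N.
    by rewrite cards_draws bin_gt0.
  rewrite card_gt0 => /set0Pn[D]; rewrite inE => /andP[DN /eqP De].
  by have := count_tail_lower DN Mm; rewrite De.
suff : (max_degree G <= e.-1)%N by lia.
by apply/bigmax_leqP => v _; have := no_v v; lia.
Qed.

End SteinEquation.

(** * Isomorphism classes of star supergraphs *)

Section StarClasses.
Context {r : nat}.
(* For r = 1 both ends of an edge are centres of one and the same subgraph. *)
Hypothesis r_gt1 : (1 < r)%N.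
Implicit Types (F : sgraph 'I_r.+1).

Definition spokes (T : finType) (v : T) : {set {set T}} :=
  [set [set v; u] | u in [set~ v]].

Lemma mem_spokes (T : finType) (v u : T) : u != v -> [set v; u] \in spokes v.
Proof. by move=> uv; apply/imsetP; exists u; rewrite ?inE. Qed.

(** A third vertex [u] separates the centres: the edge from [v] to [u] avoids [v']. *)
Lemma spokes_inj (T : finType) (v v' : T) :
  (2 < #|T|)%N -> spokes v = spokes v' -> v = v'.
Proof.
move=> T2 vv'; apply/eqP; have [//|nvv'] := eqVneq v v'.
have : (0 < #|~: [set v; v']|)%N by rewrite cardsCs setCK cards2 nvv' subn_gt0.
rewrite card_gt0 => /set0Pn[u]; rewrite !inE negb_or => /andP[uv uv'].
have : [set v; u] \in spokes v' by rewrite -vv' mem_spokes.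
move=> /imsetP[w _ /setP/(_ v')]; rewrite !inE eqxx/= ![v' == _]eq_sym.
by rewrite (negbTE nvv') (negbTE uv').
Qed.

Lemma imset_star_edges (T : finType) (f : 'I_r.+1 -> T) :
  injective f -> f @: [set: 'I_r.+1] = [set: T] ->
  [set f @: (e : {set 'I_r.+1}) | e in edges (star r)] = spokes (f ord0).
Proof.
move=> fI fT; apply/setP => e; apply/imsetP/imsetP.
  move=> [_ /imsetP[i _ ->] ->]; exists (f (lift ord0 i)).
    by rewrite !inE (inj_eq fI) eq_sym neq_lift.
  by rewrite imsetU1 imset_set1.
move=> [u]; rewrite !inE => uv ->.
have /imsetP[j _ uE] : u \in f @: [set: 'I_r.+1] by rewrite fT inE.
have [i iE|j0] := unliftP ord0 j; last by rewrite uE j0 eqxx in uv.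
exists [set ord0; lift ord0 i]; first by apply/imsetP; exists i.
by rewrite imsetU1 imset_set1 uE iE.
Qed.

(** A spanning star is determined by its centre, and all spokes at [v] are edges exactly when [v] is
    adjacent to every other vertex. *)
Lemma num_subgraphs_star F :
  num_subgraphs (star r) F = #|centers F [set: 'I_r.+1]|.
Proof.
rewrite /num_subgraphs -(@card_imset _ _
    (fun v : 'I_r.+1 => ([set: 'I_r.+1], spokes v))); last first.
  by move=> v v' [] /spokes_inj; apply; rewrite card_ord.
apply: eq_card => -[W B]; rewrite inE/=; apply/andP/imsetP.
  move=> [BF /existsP[f /and3P[/injectiveP fI /eqP fW /eqP fB]]].
  have WT : W = [set: 'I_r.+1].
    by apply/eqP; rewrite eqEcard subsetT -fW card_imset ?leqnn.
  have {}fB : B = spokes (f ord0) by rewrite -fB imset_star_edges// fW.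
  exists (f ord0); last by rewrite WT fB.
  rewrite !inE/=; apply/forall_inP => u; rewrite !inE andbT => uf.
  by apply: (subsetP BF); rewrite fB mem_spokes.
move=> [v]; rewrite inE => /andP[_ /forall_inP av] [-> ->]; split.
  apply/subsetP => _ /imsetP[u uv ->]; apply: av.
  by move: uv; rewrite !inE andbT.
(* The transposition carries the hub [ord0] of the model star to [v]. *)
pose f := [ffun i => tperm ord0 v i].
have fI : injective f by move=> i j; rewrite !ffunE => /perm_inj.
have fT : f @: [set: 'I_r.+1] = [set: 'I_r.+1].
  by apply/eqP; rewrite eqEcard subsetT card_imset ?leqnn.
apply/existsP; exists f; apply/and3P; split; first exact/injectiveP.
  by rewrite fT.
by rewrite imset_star_edges// ffunE tpermL.
Qed.

Lemma contains_star F :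
  contains (star r) F = (centers F [set: 'I_r.+1] != set0).
Proof.
apply/existsP/set0Pn => [[f /andP[/injectiveP fI /forall_inP fE]]|[v]].
  have fT : f @: [set: 'I_r.+1] = [set: 'I_r.+1].
    by apply/eqP; rewrite eqEcard subsetT card_imset ?leqnn.
  exists (f ord0); rewrite !inE/=; apply/forall_inP => u; rewrite !inE andbT => uf.
  have : [set f ord0; u] \in spokes (f ord0) by exact: mem_spokes.
  by rewrite -imset_star_edges// /adj => /imsetP[e eE ->]; apply: fE.
rewrite inE => /andP[_ /forall_inP av].
exists [ffun i => tperm ord0 v i]; apply/andP; split.
  by apply/injectiveP => i j; rewrite !ffunE => /perm_inj.
apply/forall_inP => _ /imsetP[i _ ->].
rewrite imsetU1 imset_set1 !ffunE tpermL; apply: av; rewrite !inE andbT.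
by rewrite -[X in _ != X](tpermL ord0 v) (inj_eq perm_inj) eq_sym neq_lift.
Qed.

Context {V : finType} (G : sgraph V).
Implicit Types W : {set V}.

Definition induced_edges W : {set {set V}} := [set e in edges G | e \subset W].

Lemma iso_to_adj F W (f : {ffun 'I_r.+1 -> V}) : injective f ->
  f @: [set: 'I_r.+1] = W ->
  [set f @: (e : {set 'I_r.+1}) | e in edges F] = induced_edges W ->
  forall i j, adj F i j = adj G (f i) (f j).
Proof.
move=> fI fW fE i j; have fij : f @: [set i; j] = [set f i; f j].
  by rewrite imsetU1 imset_set1.
rewrite /adj -fij; apply/idP/idP => [ij|].
  have : f @: [set i; j] \in induced_edges W by rewrite -fE imset_f.
  by rewrite inE => /andP[].
move=> ij; have : f @: [set i; j] \in induced_edges W.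
  by rewrite inE ij -fW imsetS ?subsetT.
by rewrite -fE => /imsetP[e eF /(imset_inj fI) ->].
Qed.

Lemma iso_to_centers F W : iso_to F W (induced_edges W) ->
  #|centers F [set: 'I_r.+1]| = #|centers G W|.
Proof.
move=> /existsP[f /and3P[/injectiveP fI /eqP fW /eqP fE]].
have fadj := iso_to_adj fI fW fE.
rewrite -(card_imset _ fI); apply: eq_card => v; apply/imsetP/idP.
  move=> [i /centersP[_ ai] ->]; apply/centersP.
  rewrite -fW imset_f//; split=> // _ /imsetP[j _ ->].
  by rewrite (inj_eq fI) -fadj; exact: ai.
move=> /centersP[+ av]; rewrite -fW => /imsetP[i _ vE].
exists i => //; apply/centersP; split=> // j _ ji.
by rewrite fadj -vE; apply: av; rewrite ?vE ?(inj_eq fI)// -fW imset_f.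
Qed.

Lemma iso_to_card F W B : iso_to F W B -> #|W| = r.+1.
Proof.
move=> /existsP[f /and3P[/injectiveP fI /eqP <- _]].
by rewrite card_imset// cardsT card_ord.
Qed.

(** The edges of [G] are pulled back along an enumeration of [W]. *)
Lemma iso_to_exists W : #|W| = r.+1 -> exists F, iso_to F W (induced_edges W).
Proof.
move=> Wr; pose f := [ffun i : 'I_r.+1 => enum_val (cast_ord (esym Wr) i)].
have fI : injective f.
  by move=> i j; rewrite !ffunE => /enum_val_inj/cast_ord_inj.
have fW : f @: [set: 'I_r.+1] = W.
  apply/eqP; rewrite eqEcard card_imset// cardsT card_ord Wr leqnn andbT.
  by apply/subsetP => _ /imsetP[i _ ->]; rewrite ffunE enum_valP.
pose E := [set e : {set 'I_r.+1} | f @: e \in edges G].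
have E2 : [forall e in E, #|e| == 2].
  apply/forall_inP => e; rewrite inE => /(forall_inP (edgesP G)).
  by rewrite card_imset.
exists (SGraph E2); apply/existsP; exists f; apply/and3P; split.
- exact/injectiveP.
- by rewrite fW.
- apply/eqP/setP => e; rewrite inE; apply/imsetP/andP.
    move=> [e' + ->]; rewrite inE => e'E; split => //.
    by rewrite -fW imsetS ?subsetT.
  move=> [eG eW]; have eE : f @: (f @^-1: e) = e.
    apply/setP => v; apply/imsetP/idP => [[i]|ve]; first by rewrite inE => ? ->.
    have /imsetP[i _ vE] : v \in f @: [set: 'I_r.+1] by rewrite fW (subsetP eW).
    by exists i; rewrite // inE -vE.
  by exists (f @^-1: e); rewrite ?inE eE.
Qed.

Lemma iso_to_isog F F' W B : iso_to F W B -> iso_to F' W B -> isog F F'.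
Proof.
move=> /existsP[f /and3P[/injectiveP fI /eqP fW /eqP fE]].
move=> /existsP[h /and3P[/injectiveP hI /eqP hW /eqP hE]].
have hX i : {j | h j == f i}.
  apply: sigW; have : f i \in h @: [set: 'I_r.+1] by rewrite hW -fW imset_f.
  by move=> /imsetP[j _ ->]; exists j.
pose g := [ffun i => sval (hX i)].
have gE i : h (g i) = f i by rewrite ffunE; apply/eqP/(svalP (hX i)).
have gI : injective g by move=> i j gij; apply: fI; rewrite -!gE gij.
have hgE (e : {set 'I_r.+1}) : h @: (g @: e) = f @: e.
  by rewrite -imset_comp; apply: eq_imset => i /=; exact: gE.
apply/existsP; exists g; apply/and3P; split.
- exact/injectiveP.
- by rewrite eqEcard subsetT card_imset// leqnn.
- apply/eqP/(imset_inj (imset_inj hI)); rewrite hE -fE -imset_comp.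
  by apply: eq_imset => e /=; exact: hgE.
Qed.

Lemma star_supergraphsE F W k : iso_to F W (induced_edges W) ->
  (F \in star_supergraphs r k.+1) = (#|centers G W| == k.+1).
Proof.
move=> FW; rewrite inE contains_star num_subgraphs_star (iso_to_centers FW).
by rewrite -card_gt0 (iso_to_centers FW) andb_idl// => /eqP ->.
Qed.

(** Double counting: a set [W] with [k.+1] centres induces a copy of exactly one class
    representative, and any other set of none. *)
Lemma sum_num_induced k :
  (\sum_(F in star_classes r k.+1) num_induced F G =
   #|[set W : {set V} | (#|W| == r.+1) && (#|centers G W| == k.+1)]|)%N.
Proof.
set S := [set W | _].
pose D := star_supergraphs r k.+1.
pose Q := equivalence_partition (@isog 'I_r.+1 'I_r.+1) D.
have eqD : {in D & &, equivalence_rel (@isog 'I_r.+1 'I_r.+1)}.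
  by move=> F F' F'' _ _ _; exact: isog_equivalence.
have partD : partition Q D := equivalence_partitionP eqD.
have trD : is_transversal (star_classes r k.+1) Q D := transversalP partD.
transitivity (\sum_W \sum_(F in star_classes r k.+1)
    iso_to F W (induced_edges W))%N.
  rewrite exchange_big; apply: eq_bigr => F _.
  rewrite /num_induced -sum1dep_card big_mkcond; apply: eq_bigr => W _.
  by rewrite /induced_edges; case: iso_to.
rewrite -sum1_card [RHS]big_mkcond; apply: eq_bigr => W _.
have subD := subsetP (transversal_sub trD).
case: ifPn => [|WS]; last first.
  apply: big1 => F FX; apply/eqP; rewrite eqb0; apply: contra WS => FW.
  by rewrite inE (iso_to_card FW) eqxx/= -(star_supergraphsE _ FW) subD.
rewrite inE => /andP[/eqP Wr Wk].
have [F0 F0W] := iso_to_exists Wr.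
have F0D : F0 \in D by rewrite (star_supergraphsE _ F0W).
have QF0 : pblock Q F0 \in Q by rewrite pblock_mem// (cover_partition partD).
pose F := transversal_repr F0 (star_classes r k.+1) (pblock Q F0).
have FX : F \in star_classes r k.+1 by exact: repr_mem_transversal trD _ _ QF0.
have isoF : isog F0 F.
  rewrite -(pblock_equivalence_partition eqD F0D (subD _ FX)).
  exact: repr_mem_pblock trD _ _ QF0.
(* Another representative matching [W] would be isomorphic to [F0], hence lie in the same block,
   which the transversal meets only once. *)
rewrite (bigD1 F)//= (iso_to_comp (isog_sym isoF) F0W) big1// => F' /andP[F'X F'F].
apply/eqP; rewrite eqb0; apply: contra F'F => F'W; apply/eqP.
have F'F0 : F' \in pblock Q F0.
  by rewrite (pblock_equivalence_partition eqD F0D (subD _ F'X)) (iso_to_isog F0W F'W).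
have FF0 : F \in pblock Q F0 by exact: repr_mem_pblock trD _ _ QF0.
have /and3P[_ tiQ _] := partD.
apply: (pblock_inj trD) => //.
by rewrite (same_pblock tiQ F'F0) (same_pblock tiQ FF0).
Qed.

End StarClasses.

From mathcomp Require Import all_classical all_reals all_analysis.
Import Order.TTheory GRing.Theory Num.Theory.
Import numFieldNormedType.Exports.
Local Open Scope classical_set_scope.
Local Open Scope ring_scope.

(** * Laws of functions of natural-valued random variables *)

Section DiscreteLaws.
Context d (Omega : measurableType d) {R : realType} (P : probability Omega R).

Lemma probability_finite_union (K : finType) (p : pred K) (F : K -> set Omega) :
  (forall k, measurable (F k)) -> (forall k l w, F k w -> F l w -> k = l) ->
  P [set w | exists2 k, p k & F k w] = (\sum_(k | p k) P (F k))%E.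
Proof.
move=> mF tF; rewrite -big_enum fsbig_seq ?enum_uniq//.
rewrite -measure_fin_bigcup//.
- congr (P _); apply/seteqP; split=> w [k].
    by move=> pk Fk; exists k; rewrite //= mem_enum.
  by rewrite /= mem_enum => pk Fk; exists k.
- by move=> k l _ _ [w [Fk Fl]]; exact: tF Fk Fl.
Qed.

Context {I : finType} (X : I -> {RV P >-> nat}) (g : (I -> nat) -> nat).

Definition law (m : nat) : R := fine (P [set w | g (X ^~ w) = m]).

Lemma law_preimage (m : nat) :
  [set w | g (X ^~ w) = m] = apply_family R X g @^-1` [set m%:R].
Proof.
apply/seteqP; split=> w /=; first by rewrite /apply_family => ->.
by move=> /eqP; rewrite eqr_nat => /eqP.
Qed.

Lemma measurable_law (m : nat) : measurable [set w | g (X ^~ w) = m].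
Proof.
rewrite law_preimage -[X in measurable X]setTI.
exact: measurable_apply_family.
Qed.

Lemma lawE (m : nat) : P [set w | g (X ^~ w) = m] = (law m)%:E.
Proof. by rewrite /law fineK// fin_num_measure//; exact: measurable_law. Qed.

Lemma law_ge0 m : 0 <= law m.
Proof. by rewrite /law fine_ge0. Qed.

Lemma law_le1 m : law m <= 1.
Proof. by rewrite -lee_fin -lawE probability_le1//; exact: measurable_law. Qed.

Lemma cdf_law (x : R) : cdf (apply_family R X g : {RV P >-> R}) x =
  (if x < 0 then 0 else \sum_(j < (Num.trunc x).+1) law j)%:E.
Proof.
rewrite /cdf /distribution /pushforward; case: ltP => x0.
  rewrite (_ : _ @^-1` _ = set0) ?measure0//; apply/seteqP; split=> w //=.
  by rewrite in_itv/= /apply_family => /le_lt_trans/(_ x0); rewrite ltNge ler0n.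
rewrite -sumEFin; under eq_bigr do rewrite -lawE.
rewrite -(@probability_finite_union 'I_(Num.trunc x).+1 xpredT
    (fun j => [set w | g (X ^~ w) = j])).
- congr (P _); apply/seteqP; split=> w /=.
    rewrite in_itv/= /apply_family => wx.
    have gx : (g (X ^~ w) < (Num.trunc x).+1)%N by rewrite ltnS truncn_ge_nat.
    by exists (Ordinal gx).
  move=> [j _ gj]; rewrite in_itv/= /apply_family gj -truncn_ge_nat//.
  by rewrite -ltnS.
- by move=> j; exact: measurable_law.
- by move=> j k w /= -> jk; exact: val_inj.
Qed.

Lemma sum_law_cvg1 : \sum_(j < n) law j @[n --> \oo] --> (1 : R).
Proof.
have := cvg_cdfy1 (apply_family R X g : {RV P >-> R}).
move=> /(cvg_comp _ _ (@cvgr_idn R))/fine_cvgP[_ cdf1].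
rewrite -(cvg_shiftS (fun n => \sum_(j < n) law j)); apply: cvg_trans cdf1.
apply: near_eq_cvg; near=> n.
by rewrite /= cdf_law/= ltNge ler0n/= natrK.
Unshelve. all: by end_near.
Qed.

Hypothesis X_indep : mutually_independent X.

Lemma joint_law (f : I -> nat) :
  P [set w | forall i, X i w = f i] = (\prod_i P (X i @^-1` [set f i]))%E.
Proof.
transitivity (\prod_(i in [set: I]%SET) P (X i @^-1` [set f i]))%E; last first.
  by apply: eq_bigl => i; rewrite inE.
rewrite -(X_indep [set: I]%SET (A := fun i => [set f i]))//.
congr (P _); apply/seteqP; split=> w /=; first by move=> wf i _; exact: wf.
by move=> wf i; apply: wf; rewrite /= inE.
Qed.

Lemma measurable_joint (f : I -> nat) :
  measurable [set w | forall i, X i w = f i].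
Proof.
rewrite (_ : [set w | _] = \bigcap_(i in [set: I]) X i @^-1` [set f i]).
  apply: fin_bigcap_measurable => [|i _]; first exact: finite_finset.
  exact: measurable_funPTI.
by apply/seteqP; split=> [w Xf i _|w Xf i]; exact: Xf.
Qed.

(** Finitely many allowed values turn the law into a finite sum; [e] will be the successor for
    colours and the inclusion of ['I_N] for Poisson variables. *)
Lemma law_finite_values (N : nat) (e : 'I_N -> nat) (m : nat) : injective e ->
  P [set w | g (X ^~ w) = m /\ forall i, exists k, X i w = e k] =
  (\sum_(f : {ffun I -> 'I_N} | g (e \o f) == m)
    \prod_i P (X i @^-1` [set e (f i)]))%E.
Proof.
move=> eI; under eq_bigr do rewrite -joint_law.
rewrite -(@probability_finite_union _ _
  (fun f : {ffun I -> 'I_N} => [set w | forall i, X i w = e (f i)])).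
- congr (P _); apply/seteqP; split=> w /=.
    move=> [gw /(_ _)/cid wk]; exists [ffun i => sval (wk i)].
      apply/eqP; rewrite -gw; congr g; apply/funext => i /=.
      by rewrite ffunE; exact/esym/(svalP (wk i)).
    by move=> i; rewrite ffunE; exact: (svalP (wk i)).
  move=> [f /eqP gf wf]; split=> [|i]; last by exists (f i).
  by rewrite -gf; congr g; apply/funext.
- by move=> f; exact: measurable_joint.
- by move=> f h w /= wf wh; apply/ffunP => i; apply: eI; rewrite -wf.
Qed.

End DiscreteLaws.

(** * The star count under the random colouring *)

Section ColoringLaw.
Context d (Omega : measurableType d) {R : realType} (P : probability Omega R).
Context {V : finType} (X : V -> {RV P >-> nat}) (r c : nat) (G : sgraph V).
Hypotheses (c_gt0 : (0 < c)%N) (X_indep : mutually_independent X).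
Hypothesis X_unif : forall v, uniform_on_1_to c (X v).

Lemma law_in_range (g : (V -> nat) -> nat) (m : nat) :
  P [set w | g (X ^~ w) = m /\ forall v, exists k : 'I_c, X v w = k.+1] =
  (expect (fun x : {ffun V -> 'I_c} => (g (fun v => (x v).+1) == m)%:R : R))%:E.
Proof.
rewrite (@law_finite_values _ _ _ _ _ _ _ X_indep _ (fun k : 'I_c => k.+1)); last first.
  by move=> k l [] /val_inj.
rewrite /expect mulr_suml -sumEFin [LHS]big_mkcond/=.
apply: eq_bigr => f _; case: ifPn => gf; last by rewrite mul0r.
rewrite mul1r -exprVn -(prodr_const (mem V)) -prodEFin.
by apply: eq_bigr => v _; rewrite X_unif/= ltn_ord.
Qed.

Lemma law_mono_stars m :
  law X (mono_stars r G) m = count_prob (c := c) (r := r) G m.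
Proof.
pose B : set Omega := [set w | forall v, exists k : 'I_c, X v w = k.+1].
have mB : measurable B.
  rewrite (_ : B = \bigcap_(v in [set: V]) X v @^-1` [set j | exists k : 'I_c, j = k.+1]).
    apply: fin_bigcap_measurable => [|v _]; first exact: finite_finset.
    exact: measurable_funPTI.
  by apply/seteqP; split=> [w Xw v _|w Xw v]; exact: Xw.
(* Colours lie in the range almost surely: [law_in_range] for the constant statistic 0 gives [B]
   probability 1. *)
have PB : P (~` B) = 0%E.
  rewrite probability_setC// -(_ : P [set w | (fun=> 0%N) (X ^~ w) = 0%N /\ B w] = P B).
    rewrite (law_in_range (fun=> 0%N) 0) (@eq_expect _ _ _ _ (fun=> 1))//.
    by rewrite expect_cst// subee.
  by congr (P _); apply/seteqP; split=> w /= => [[]|].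
rewrite /law; set A := [set w | _].
have mA : measurable A by exact: measurable_law.
have PAB : P (A `\` B) = 0%E.
  apply/eqP; rewrite -measure_le0 -PB le_measure ?inE//.
  - exact: measurableD.
  - exact: measurableC.
have -> : P A = P (A `&` B) by rewrite -[RHS]add0e -PAB; exact: measureDI.
rewrite (_ : A `&` B = [set w | mono_stars r G (X ^~ w) = m /\
    forall v, exists k : 'I_c, X v w = k.+1])//.
rewrite law_in_range /= /count_prob; apply: eq_expect => x.
by rewrite -mono_stars_count.
Qed.

End ColoringLaw.

(** * Panjer's recursion for the compound Poisson law *)

Section CompoundPoisson.
Context d (Omega : measurableType d) {R : realType} (P : probability Omega R).
Context {r : nat} (lambda : 'I_r.+1 -> R) (Z : 'I_r.+1 -> {RV P >-> nat}).
Hypotheses (lambda_ge0 : forall k, 0 <= lambda k)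
  (Z_indep : mutually_independent Z)
  (Z_poisson : forall k, poisson_distributed (lambda k) (Z k)).

Let pois k (j : nat) : R := lambda k ^+ j / j`!%:R * expR (- lambda k).

Let pois_ge0 k j : 0 <= pois k j.
Proof. by rewrite !mulr_ge0// ?exprn_ge0// expR_ge0. Qed.

Let pois0_gt0 k : 0 < pois k 0.
Proof. by rewrite /pois expr0 fact0 divr1 mul1r expR_gt0. Qed.

(** The one-variable form of Panjer's recursion, from which the general one is assembled. *)
Let poisS k j : j.+1%:R * pois k j.+1 = lambda k * pois k j.
Proof.
rewrite /pois exprS factS natrM invfM.
rewrite [X in X = _](_ : _ = j.+1%:R / j.+1%:R *
  (lambda k * (lambda k ^+ j / j`!%:R * expR (- lambda k)))); last by ring.
by rewrite divff ?mul1r// pnatr_eq0.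
Qed.

Lemma poissonE k j : P (Z k @^-1` [set j]) = (pois k j)%:E.
Proof.
have := Z_poisson k [set j]; rewrite /distribution /pushforward => ->.
rewrite /poisson_prob /pois; case: ltP => lk.
  by rewrite esum_set1 ?lee_fin ?poisson_pmf_ge0// /poisson_pmf lk.
have -> : lambda k = 0 by apply/eqP; rewrite eq_le lk lambda_ge0.
rewrite oppr0 expR0 mulr1 diracE; case: j => [|j].
  by rewrite expr0 fact0 divr1 mem_set.
by rewrite expr0n mul0r memNset.
Qed.

Let ws_le (f : 'I_r.+1 -> nat) k : (f k <= weighted_sum f)%N.
Proof. by rewrite /weighted_sum (bigD1 k)//= mulSn -addnA leq_addr. Qed.

Local Notation q := (law Z (@weighted_sum r)).

Let wsum N (f : {ffun 'I_r.+1 -> 'I_N}) : nat :=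
  weighted_sum (fun k => f k : nat).

(** No summand exceeds the weighted sum, so any truncation level [N] above [m] loses nothing. *)
Lemma compound_lawE N m : (m < N)%N -> q m =
  \sum_(f : {ffun 'I_r.+1 -> 'I_N} | wsum f == m) \prod_k pois k (f k).
Proof.
move=> mN; apply/EFin_inj; rewrite -lawE -sumEFin.
rewrite (_ : [set w | _] = [set w | weighted_sum (Z ^~ w) = m /\
    forall k, exists j : 'I_N, Z k w = j]); last first.
  apply/seteqP; split=> w /= => [wm|[]//]; split=> // k.
  have Zk : (Z k w < N)%N by rewrite (leq_ltn_trans (ws_le (Z ^~ w) k))// wm.
  by exists (Ordinal Zk).
rewrite (@law_finite_values _ _ _ _ _ _ _ Z_indep _ (@nat_of_ord N)); last exact: val_inj.
apply: eq_bigr => f _; rewrite -prodEFin; apply: eq_bigr => k _.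
exact: poissonE.
Qed.

Lemma compound_law0_gt0 : 0 < q 0%N.
Proof.
rewrite (@compound_lawE 1%N)//.
pose f0 := [ffun k : 'I_r.+1 => ord0 : 'I_1].
rewrite (bigD1 f0)/=; last first.
  by rewrite /wsum /weighted_sum big1// => k _; rewrite ffunE muln0.
rewrite ltr_pwDl ?sumr_ge0// => [|f _]; last exact: prodr_ge0.
by apply: prodr_gt0 => k _; rewrite ffunE.
Qed.

(** By [poisS] the factor [f k] lowers coordinate [k] by one at the price of [lambda k], and this
    lowers the weighted sum by [k.+1]. The maps [inc] and [dec] realize the change of variables. *)
Let shift_term m k :
  \sum_(f : {ffun 'I_r.+1 -> 'I_m.+1} | wsum f == m)
     (f k)%:R * \prod_i pois i (f i) =
  lambda k * (if (k < m)%N then q (m - k.+1)%N else 0).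
Proof.
pose inc (f : {ffun 'I_r.+1 -> 'I_m.+1}) :=
  [ffun i => if i == k then inord (f i).+1 else f i].
pose dec (f : {ffun 'I_r.+1 -> 'I_m.+1}) :=
  [ffun i => if i == k then inord (f i).-1 else f i].
transitivity (\sum_(f : {ffun 'I_r.+1 -> 'I_m.+1} |
    (wsum f + k.+1 == m)%N) lambda k * \prod_i pois i (f i)).
  rewrite (bigID (fun f : {ffun 'I_r.+1 -> 'I_m.+1} => f k == ord0))/=.
  rewrite big1 ?add0r; last by move=> f /andP[_ /eqP ->]; rewrite mul0r.
  rewrite (reindex_onto inc dec)/=; last first.
    move=> f /andP[_ fk]; apply/ffunP => i; rewrite !ffunE; case: eqP => // ->.
    have dk : (inord (f k).-1 : 'I_m.+1) = (f k).-1 :> nat.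
      by rewrite inordK// (leq_ltn_trans (leq_pred _)).
    by rewrite dk prednK ?lt0n// inord_val.
  have ws_inc (h : {ffun 'I_r.+1 -> 'I_m.+1}) : (h k < m)%N ->
      (wsum (inc h) = wsum h + k.+1)%N.
    move=> hk; rewrite /wsum /weighted_sum (bigD1 k)//= [in RHS](bigD1 k)//= ffunE eqxx.
    rewrite inordK// mulnS -addnA [RHS]addnC; congr (_ + (_ + _))%N.
    by apply: eq_bigr => i /negbTE ik; rewrite ffunE ik.
  apply: eq_big => [h|h /andP[/andP[_ hk] _]].
    have [hk|hk] := ltnP (h k) m.
      rewrite ws_inc// ffunE eqxx.
      have -> : (inord (h k).+1 != ord0 :> 'I_m.+1).
        by rewrite -val_eqE/= inordK.
      rewrite andbT; apply: andb_idr => _; apply/eqP/ffunP => i.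
      rewrite !ffunE; case: eqP => // ->; apply: val_inj.
      by rewrite /= !inordK//= ltnS ltnW.
    have hkm : h k = m :> nat by apply/eqP; rewrite eqn_leq hk -ltnS ltn_ord.
    (* When [h k = m] the increment overflows and [inord] falls back to 0; the index conditions on
       both sides then fail. *)
    rewrite [inc h k]ffunE eqxx hkm.
    have -> : inord m.+1 = ord0 :> 'I_m.+1.
      by apply: val_inj; rewrite /inord /insubd insubF//= ltnn.
    rewrite eqxx andbF/= gtn_eqF// (leq_trans _ (leq_add (ws_le _ k) (leqnn _)))//.
    by rewrite hkm addnS ltnS leq_addr.
  have hkm : (h k < m)%N.
    rewrite ltnNge; apply/negP => mh; move: hk; rewrite ffunE eqxx.
    have -> : h k = m :> nat by apply/eqP; rewrite eqn_leq mh -ltnS ltn_ord.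
    by rewrite /inord /insubd insubF//= ?ltnn// => /eqP; apply; apply: val_inj.
  rewrite (bigD1 k)//= [in RHS](bigD1 k)//= ffunE eqxx inordK//.
  rewrite [LHS]mulrA poisS -[LHS]mulrA; congr (_ * (_ * _)).
  by apply: eq_bigr => i /negbTE ik; rewrite ffunE ik.
rewrite -mulr_sumr; congr (_ * _); case: ifPn => [km|]; last first.
  rewrite -leqNgt => mk; apply: big1 => f /eqP fm.
  have : (k < m)%N by rewrite -fm addnS ltnS leq_addl.
  by rewrite ltnNge mk.
rewrite (@compound_lawE m.+1); last by rewrite ltnS leq_subr.
by apply: eq_bigl => f; rewrite -[RHS](eqn_add2r k.+1) subnK.
Qed.

(** On the event that the weighted sum is [m], the factor [m] splits into the terms [k.+1 * f k],
    each handled by [shift_term]. *)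
Lemma panjer m : m%:R * q m = \sum_(k < r.+1) k.+1%:R * lambda k *
   (if (k < m)%N then q (m - k.+1)%N else 0).
Proof.
rewrite (compound_lawE (ltnSn m)) mulr_sumr.
transitivity (\sum_(f : {ffun 'I_r.+1 -> 'I_m.+1} | wsum f == m)
   \sum_(k < r.+1) k.+1%:R * ((f k)%:R * \prod_i pois i (f i))).
  apply: eq_bigr => f /eqP fm; rewrite -[X in X%:R * _]fm.
  rewrite /wsum /weighted_sum natr_sum mulr_suml.
  by apply: eq_bigr => k _; rewrite natrM mulrA.
rewrite exchange_big/=; apply: eq_bigr => k _.
by rewrite -mulr_sumr shift_term mulrA.
Qed.

End CompoundPoisson.

(** * Limits of approximate solutions of Panjer's recursion *)

Section RealLimits.
Context {R : realType}.
Implicit Types (u v : nat -> R).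

Lemma cvg_sum_ord (N : nat) (f : 'I_N -> nat -> R) (l : 'I_N -> R) :
  (forall i, f i n @[n --> \oo] --> l i) ->
  \sum_(i < N) f i n @[n --> \oo] --> \sum_(i < N) l i.
Proof.
move=> fl; rewrite (_ : (fun n => _) = \sum_(i < N) f i); last first.
  by apply/funext => n; rewrite fct_sumE.
by apply: (big_rec2 (fun (g : nat -> R) (a : R) => g n @[n --> \oo] --> a)) => [|i a g _ ga];
  [exact: cvg_cst|exact: cvgD].
Qed.

Lemma cvg0_normr_le u v : (\forall n \near \oo, `|u n| <= v n) ->
  v n @[n --> \oo] --> (0 : R) -> u n @[n --> \oo] --> (0 : R).
Proof.
move=> uv v0; apply/norm_cvg0P; apply: (@squeeze_cvgr _ _ _ _ (cst 0) v) => //.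
  by apply: filterS uv => n ->; rewrite normr_ge0.
exact: cvg_cst.
Qed.

Lemma cvgB0 u v (l : R) : u n - v n @[n --> \oo] --> (0 : R) ->
  v n @[n --> \oo] --> l -> u n @[n --> \oo] --> l.
Proof.
move=> uv vl; rewrite -[l]add0r.
rewrite (_ : (fun n => u n) = (fun n => (u n - v n) + v n)); first exact: cvgD.
by apply/funext => n; rewrite subrK.
Qed.

End RealLimits.

Section PanjerLimits.
Context {R : realType} {r : nat}.
Context (p : nat -> nat -> R) (mu : nat -> 'I_r.+1 -> R) (q : nat -> R).
Context (lambda : 'I_r.+1 -> R).

Definition panjer_sum (a : 'I_r.+1 -> R) (f : nat -> R) (m : nat) : R :=
  \sum_(k < r.+1) k.+1%:R * a k * (if (k < m)%N then f (m - k.+1)%N else 0).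

Let mean n := \sum_(k < r.+1) k.+1%:R * mu n k.

Hypotheses (p_ge0 : forall n m, 0 <= p n m) (p_le1 : forall n m, p n m <= 1).
Hypothesis mu_ge0 : forall n k, 0 <= mu n k.
Hypothesis markov : forall n M, M%:R * (1 - \sum_(j < M) p n j) <= mean n.
Hypothesis tail_ge0 : forall n M, 0 <= 1 - \sum_(j < M) p n j.
Hypotheses (q_ge0 : forall m, 0 <= q m) (q0_gt0 : 0 < q 0%N).
Hypothesis q_sum : \sum_(j < n) q j @[n --> \oo] --> (1 : R).
Hypothesis lambda_ge0 : forall k, 0 <= lambda k.
Hypothesis q_panjer : forall m, m%:R * q m = panjer_sum lambda q m.

Hypothesis p_panjer :
  forall m, m%:R * p n m - panjer_sum (mu n) (p n) m @[n --> \oo] --> (0 : R).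

Lemma panjer_cvg : (forall k, mu n k @[n --> \oo] --> lambda k) ->
  forall m, p n m @[n --> \oo] --> q m.
Proof.
move=> mul.
(* The recursion fixes the masses only up to the common factor [p n 0], so the ratios come first. *)
have rel m : p n m - q m / q 0%N * p n 0%N @[n --> \oo] --> (0 : R).
  have [M] := ubnP m; elim: M m => // M IH [|m] mM.
    rewrite (_ : (fun n => _) = cst 0); first exact: cvg_cst.
    by apply/funext => n /=; rewrite divff ?gt_eqF// mul1r subrr.
  (* Three errors: the residual of the recursion, the change of rates from [mu n] to [lambda], and
     the earlier differences covered by induction. *)
  rewrite (_ : (fun n => _) = (fun n => m.+1%:R^-1 *
      ((m.+1%:R * p n m.+1 - panjer_sum (mu n) (p n) m.+1) +
       \sum_(k < r.+1) k.+1%:R * ((mu n k - lambda k) *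
          (if (k < m.+1)%N then p n (m.+1 - k.+1)%N else 0) + lambda k *
          (if (k < m.+1)%N then p n (m.+1 - k.+1)%N -
             q (m.+1 - k.+1)%N / q 0%N * p n 0%N else 0))))); last first.
    apply/funext => n.
    have m0 : m.+1%:R != 0 :> R by rewrite pnatr_eq0.
    apply: (mulfI m0); rewrite [RHS]mulrA divff// mul1r.
    transitivity (m.+1%:R * p n m.+1 - panjer_sum lambda q m.+1 / q 0%N * p n 0%N).
      by rewrite -q_panjer; ring.
    rewrite -addrA; congr (_ + _).
    rewrite /panjer_sum !mulr_suml -!sumrN -big_split/=.
    by apply: eq_bigr => k _; case: ifP => _; ring.
  rewrite -[X in _ --> X](mulr0 m.+1%:R^-1); apply: cvgM; first exact: cvg_cst.
  rewrite -[X in _ --> X](addr0 0); apply: cvgD; first exact: p_panjer.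
  rewrite -[X in _ --> X](_ : \sum_(k < r.+1) 0 = 0 :> R); last by rewrite big1.
  apply: cvg_sum_ord => k.
  rewrite -[X in _ --> X](mulr0 k.+1%:R); apply: cvgM; first exact: cvg_cst.
  rewrite -[X in _ --> X](addr0 0); apply: cvgD.
    apply: (@cvg0_normr_le _ _ (fun n => `|mu n k - lambda k|)).
      apply: nearW => n; case: ifP => _; last by rewrite mulr0 normr0 normr_ge0.
      by rewrite normrM ler_piMr// ger0_norm.
    by apply/norm_cvg0P/subr_cvg0.
  rewrite -[X in _ --> X](mulr0 (lambda k)); apply: cvgM; first exact: cvg_cst.
  case: (ltnP k m.+1) => km; last exact: cvg_cst.
  by apply: IH; rewrite subSS (leq_ltn_trans (leq_subr _ _)).
have q_le1 N : \sum_(j < N) q j <= 1.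
  have nd : nondecreasing_seq (fun n => \sum_(j < n) q j).
    by apply/nondecreasing_seqP => n; rewrite big_ord_recr/= lerDl.
  rewrite -(cvg_lim _ q_sum)//; apply: nondecreasing_cvgn_le => //.
  exact: cvgP q_sum.
have mean_cvg : mean n @[n --> \oo] --> \sum_(k < r.+1) k.+1%:R * lambda k.
  by apply: cvg_sum_ord => k; apply: cvgM; [exact: cvg_cst|exact: mul].
pose C := \sum_(k < r.+1) k.+1%:R * lambda k + 1.
have C_gt0 : 0 < C.
  by rewrite ltr_wpDl ?ltr01// sumr_ge0// => k _; rewrite mulr_ge0.
have p0 : p n 0%N @[n --> \oo] --> q 0%N.
  apply/cvgrPdist_le => e e0.
  have [M0 _ M0P] : \forall M \near \oo, `|1 - \sum_(j < M) q j| <= e / 3.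
    by move/cvgrPdist_le : q_sum; apply; rewrite divr_gt0.
  (* [M0] makes the tail of [q] at most [e / 3]; the other bound does the same for [q 0] times
     Markov's bound [C / M]. *)
  pose M := maxn M0 (Num.trunc (3 * C * q 0%N / e)).+1.
  have M_q : 1 - \sum_(j < M) q j <= e / 3.
    by apply: le_trans (ler_norm _) _; apply: M0P; rewrite /= leq_maxl.
  have M_gt0 : 0 < M%:R :> R by rewrite ltr0n leq_max ltn0Sn orbT.
  have M_C : q 0%N * (C / M%:R) <= e / 3.
    have : 3 * C * q 0%N / e <= M%:R.
      apply: ltW; apply: lt_le_trans (truncnS_gt _) _.
      by rewrite ler_nat leq_maxr.
    by rewrite ler_pdivrMr// mulrA ler_pdivrMr// => h; lra.
  have relM : q 0%N * \sum_(j < M) (p n j - q j / q 0%N * p n 0%N)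
      @[n --> \oo] --> (0 : R).
    rewrite -[X in _ --> X](mulr0 (q 0%N)); apply: cvgM; first exact: cvg_cst.
    rewrite -[X in _ --> X](_ : \sum_(k < M) 0 = 0 :> R); last by rewrite big1.
    by apply: cvg_sum_ord => j; exact: rel.
  have e3 : 0 < e / 3 by rewrite divr_gt0.
  near=> n.
  have mC : mean n <= C.
    near: n; apply: (cvgr_le _ mean_cvg).
    by rewrite ltrDl ltr01.
  have rM : `|q 0%N * \sum_(j < M) (p n j - q j / q 0%N * p n 0%N)| <= e / 3.
    by near: n; move/cvgr0Pnorm_le : relM; apply.
  (* The difference is split into the tail of [p n], the ratio errors and the tail of [q]. *)
  have -> : q 0%N - p n 0%N = q 0%N * (1 - \sum_(j < M) p n j) +
      q 0%N * \sum_(j < M) (p n j - q j / q 0%N * p n 0%N) -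
      (1 - \sum_(j < M) q j) * p n 0%N.
    rewrite sumrB -!mulr_suml; field.
    by rewrite gt_eqF.
  have tM := tail_ge0 n M.
  have h1 : `|q 0%N * (1 - \sum_(j < M) p n j)| <= e / 3.
    rewrite ger0_norm ?mulr_ge0//; apply: le_trans M_C.
    rewrite ler_wpM2l// ler_pdivlMr// mulrC.
    exact: le_trans (markov n M) mC.
  have h3 : `|(1 - \sum_(j < M) q j) * p n 0%N| <= e / 3.
    rewrite ger0_norm ?mulr_ge0 ?subr_ge0//; apply: le_trans M_q.
    by rewrite ler_piMr// subr_ge0.
  apply: le_trans (ler_normB _ _) _; apply: le_trans (lerD (ler_normD _ _) h3) _.
  apply: le_trans (lerD (lerD h1 rM) (lexx _)) _.
  by lra.
move=> m; apply: (cvgB0 (rel m)).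
rewrite -[X in _ --> X](_ : q m / q 0%N * q 0%N = q m); last by rewrite mulfVK// gt_eqF.
by apply: cvgM => //; exact: cvg_cst.
Unshelve. all: by end_near.
Qed.

(** At index [k.+1] the rate [mu n k] appears only with the factor [p n 0]; smaller rates converge
    by induction and larger ones are absent. Division by [p n 0] is safe because its limit is
    positive. *)
Lemma panjer_cvg_rates : (forall m, p n m @[n --> \oo] --> q m) ->
  forall k, mu n k @[n --> \oo] --> lambda k.
Proof.
move=> pq [k]; have [M] := ubnP k; elim: M k => // M IH k kM kr.
set k0 := Ordinal kr.
have rel : mu n k0 * p n 0%N @[n --> \oo] --> lambda k0 * q 0%N.
  have k1 : k.+1%:R != 0 :> R by rewrite pnatr_eq0.
  have step (a : 'I_r.+1 -> R) (f : nat -> R) : a k0 * f 0%N = k.+1%:R^-1 *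
      (panjer_sum a f k.+1 - \sum_(j < r.+1 | j != k0)
        j.+1%:R * a j * (if (j < k.+1)%N then f (k.+1 - j.+1)%N else 0)).
    rewrite /panjer_sum (bigD1 k0)//= ltnSn subnn addrK.
    by rewrite !mulrA mulVf// mul1r.
  rewrite step -q_panjer (_ : (fun n => _) = (fun n => k.+1%:R^-1 *
      ((k.+1%:R * p n k.+1 -
        (k.+1%:R * p n k.+1 - panjer_sum (mu n) (p n) k.+1)) -
      \sum_(j < r.+1 | j != k0) j.+1%:R * mu n j *
        (if (j < k.+1)%N then p n (k.+1 - j.+1)%N else 0)))); last first.
    by apply/funext => n; rewrite step subKr.
  apply: cvgM; first exact: cvg_cst.
  apply: cvgB.
    rewrite -[X in _ --> X]subr0; apply: cvgB; last exact: p_panjer.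
    by apply: cvgM; [exact: cvg_cst|exact: pq].
  rewrite [X in _ --> X]big_mkcond/=.
  rewrite (_ : (fun n => _) = (fun n => \sum_(j < r.+1) if j != k0 then
      j.+1%:R * mu n j * (if (j < k.+1)%N then p n (k.+1 - j.+1)%N else 0)
      else 0)); last by apply/funext => n; rewrite big_mkcond.
  apply: cvg_sum_ord => -[j jr]; case: (eqVneq (Ordinal jr) k0) => jk /=.
    exact: cvg_cst.
  case: (ltnP j k.+1) => jk1; last first.
    by rewrite mulr0; under eq_fun do rewrite mulr0; exact: cvg_cst.
  have jk2 : (j < k)%N.
    rewrite ltn_neqAle -ltnS jk1 andbT.
    by apply: contraNneq jk => jk; apply/eqP/val_inj.
  apply: cvgM; last exact: pq.
  apply: cvgM; first exact: cvg_cst.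
  by apply: IH; rewrite (leq_trans jk2).
rewrite -[X in _ --> X](mulfK (lt0r_neq0 q0_gt0)).
have : mu n k0 * p n 0%N / p n 0%N @[n --> \oo] --> lambda k0 * q 0%N / q 0%N.
  by apply: cvgM => //; apply: cvgV; [exact: lt0r_neq0|exact: pq].
apply: cvg_trans; apply: near_eq_cvg; near=> n.
rewrite mulfK// lt0r_neq0//; near: n; apply: (cvgr_gt _ (pq 0%N)).
exact: q0_gt0.
Unshelve. all: by end_near.
Qed.

Lemma panjer_mean_bounded (eps : nat -> R) :
  (\forall n \near \oo, forall m,
    `|m%:R * p n m - panjer_sum (mu n) (p n) m| <= mean n * eps n) ->
  eps n @[n --> \oo] --> (0 : R) ->
  p n 0%N @[n --> \oo] --> q 0%N ->
  exists C, \forall n \near \oo, mean n <= C.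
Proof.
(* The recursion at [1, ..., r.+1] bounds [mean n * p n 0] by [r.+1 ^ 2] plus
   [r.+1 * (mean n * eps n)]. With [p n 0 >= q 0 / 2] and the last term at most
   [mean n * (q 0 / 4)], a quarter of [q 0] remains. *)
move=> err eps0 p0; exists (4 * r.+1%:R ^+ 2 / q 0%N).
near=> n.
have mean_ge0 : 0 <= mean n.
  by apply: sumr_ge0 => k _; rewrite mulr_ge0.
have errn : forall m, `|m%:R * p n m - panjer_sum (mu n) (p n) m| <= mean n * eps n.
  by near: n.
have eps_le : `|eps n| <= q 0%N / 4 / r.+1%:R.
  by near: n; move/cvgr0Pnorm_le : eps0; apply; rewrite !divr_gt0.
have p0_ge : q 0%N / 2 <= p n 0%N.
  by near: n; apply: (cvgr_ge _ p0); rewrite ltr_pdivrMr// ltr_pMr// ltr1n.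
have term (k : 'I_r.+1) : k.+1%:R * mu n k * p n 0%N <= r.+1%:R + mean n * eps n.
  apply: (@le_trans _ _ (panjer_sum (mu n) (p n) k.+1)).
    rewrite /panjer_sum (bigD1 k)//= ltnSn subnn lerDl sumr_ge0// => j _.
    by rewrite !mulr_ge0//; case: ifP.
  have := errn k.+1; rewrite ler_norml => /andP[+ _].
  have : k.+1%:R * p n k.+1 <= r.+1%:R.
    by apply: le_trans (ler_piMr _ (p_le1 _ _)) _; rewrite // ler_nat.
  by lra.
have sum_le : mean n * p n 0%N <= r.+1%:R * (r.+1%:R + mean n * eps n).
  rewrite /mean mulr_suml; apply: le_trans (ler_sum _ (fun k _ => term k)) _.
  by rewrite sumr_const card_ord -[leLHS]mulr_natl.
have r0 : 0 < r.+1%:R :> R by rewrite ltr0n.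
have h1 : r.+1%:R * (mean n * eps n) <= mean n * (q 0%N / 4).
  rewrite mulrCA ler_wpM2l//.
  apply: (@le_trans _ _ (r.+1%:R * (q 0%N / 4 / r.+1%:R))).
    by rewrite ler_wpM2l// (le_trans (ler_norm _)).
  by rewrite mulrC divfK// gt_eqF.
have h2 : mean n * (q 0%N / 2) <= mean n * p n 0%N by rewrite ler_wpM2l.
rewrite ler_pdivlMr// expr2; move: sum_le; rewrite mulrDr => sum_le.
by lra.
Unshelve. all: by end_near.
Qed.

End PanjerLimits.
(** * Tails and the maximum degree *)

Lemma bin2_leq_bin t j : ('C(t, 2) <= 'C(t + j, 2 + j))%N.
Proof.
elim: j => [|j IH]; first by rewrite !addn0.
by rewrite !addnS binS (leq_trans IH)// leq_addl.
Qed.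

(** With [t = m - (r - 2)], the binomial is at least ['C(t, 2)]; the constant 9 gives
    [t - 1 >= 8 * r.+1], so this quadratic exceeds the linear side. *)
Lemma linear_leq_bin r m : (1 < r)%N -> (9 * r.+1 + r <= m)%N ->
  (r.+1 * (2 * m) <= 'C(m, r))%N.
Proof.
case: r => [|[|j]]// _; set t := (m - j)%N => mj.
have -> : m = (t + j)%N by rewrite /t; lia.
rewrite -(add2n j); apply: leq_trans (bin2_leq_bin t j).
have tt : (9 * j.+3 <= t)%N by rewrite /t; lia.
have : ('C(t, 2) * 2 = t * t.-1)%N.
  by rewrite -[2%N in LHS]/(2`!)%N bin_ffact ffactnS ffactn1.
have : (8 * j.+3 * t <= t * t.-1)%N by rewrite mulnC leq_mul2l; lia.
have : (j.+3 * (2 * (t + j)) <= j.+3 * (2 * (t + t)))%N.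
  by rewrite !leq_mul2l; lia.
lia.
Qed.

Lemma exp_leq_ffact e m k : (k <= m)%N -> ((e - m) ^ k <= e ^_ k)%N.
Proof.
elim: k => // k IH km; rewrite ffactnSr expnSr.
by apply: leq_mul; [exact/IH/ltnW|exact/leq_sub2l/ltnW].
Qed.

Lemma fact_exp_leq m : (m`! * m ^ m <= (2 * m)`!)%N.
Proof.
suff H k : (m`! * m ^ k <= (m + k)`!)%N by rewrite mul2n -addnn.
elim: k => [|k IH]; first by rewrite muln1 addn0.
by rewrite addnS factS expnSr mulnA mulnC leq_mul// (leq_trans (leq_addr k m)).
Qed.

(** * A lower bound for binomial probabilities *)

Section BinomialLower.
Context {R : realFieldType}.

Lemma bernoulli_lower (x : R) n : 0 <= x -> x <= 1 ->
  1 - n%:R * x <= (1 - x) ^+ n.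
Proof.
move=> x0 x1; elim: n => [|n IH]; first by rewrite mul0r subr0 expr0.
rewrite exprS; apply: (@le_trans _ _ ((1 - x) * (1 - n%:R * x))); last first.
  by rewrite ler_wpM2l// subr_ge0.
have : 0 <= n%:R * (x * x) by rewrite !mulr_ge0.
by rewrite -natr1; lra.
Qed.

(** Here [e - m] lies between [delta * c / 2] and [c / 2]: the lower bound gives
    [(delta / 2) ^+ m / m!] for the first factors, the upper one gives [1 / 2] for the last by
    Bernoulli's inequality. *)
Lemma binomial_lower (delta : R) (c m e : nat) :
  0 < delta -> delta <= 1 / 2 -> (0 < m)%N -> (0 < c)%N ->
  2 * m%:R <= delta * c%:R -> delta * c%:R <= e%:R ->
  e%:R <= delta * c%:R + 1 ->
  (delta / 2) ^+ m / (2 * m`!%:R) <=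
  'C(e, m)%:R * (c%:R^-1 ^+ m * (1 - c%:R^-1) ^+ (e - m)).
Proof.
move=> d0 d2 m0 c0 mc ce ec.
have c0' : 0 < c%:R :> R by rewrite ltr0n.
have m1 : 1 <= m%:R :> R by rewrite ler1n.
have dc : delta * c%:R <= 1 / 2 * c%:R by rewrite ler_wpM2r// ltW.
have me : (m <= e)%N by rewrite -(ler_nat R); lra.
have emE : (e - m)%:R = e%:R - m%:R :> R by rewrite natrB.
have h1 : (delta / 2) ^+ m / m`!%:R <= 'C(e, m)%:R * c%:R^-1 ^+ m.
  rewrite ler_pdivrMr ?ltr0n ?fact_gt0// mulrAC -natrM bin_ffact.
  apply: (@le_trans _ _ (((e - m) ^ m)%N%:R * c%:R^-1 ^+ m)).
    rewrite natrX -exprMn; apply: lerXn2r; rewrite ?nnegrE.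
    - by rewrite divr_ge0// ltW.
    - by rewrite mulr_ge0// invr_ge0.
    - by rewrite ler_pdivlMr// emE; lra.
  by rewrite ler_wpM2r ?exprn_ge0 ?invr_ge0// ler_nat exp_leq_ffact.
have h2 : 1 / 2 <= (1 - c%:R^-1) ^+ (e - m) :> R.
  apply: le_trans (bernoulli_lower _ _ _); last 2 first.
  - by rewrite invr_ge0.
  - by rewrite invf_le1// ler1n.
  have : (e - m)%:R / c%:R <= 1 / 2 :> R.
    by rewrite ler_pdivrMr// emE; lra.
  by lra.
rewrite mulrA; apply: le_trans (ler_pM _ _ h1 h2).
- by rewrite le_eqVlt; apply/orP; left; apply/eqP; field; rewrite pnatr_eq0 -lt0n fact_gt0.
- by rewrite divr_ge0// exprn_ge0// divr_ge0// ltW.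
- by [].
Qed.

End BinomialLower.

(** * Tail of the limit law and the maximum degree *)

Section CompoundTail.
Context {R : realType} {r : nat} (q : nat -> R) (lambda : 'I_r.+1 -> R).
Hypothesis q_ge0 : forall m, 0 <= q m.
Hypothesis q_sum : \sum_(j < n) q j @[n --> \oo] --> (1 : R).
Hypothesis lambda_ge0 : forall k, 0 <= lambda k.
Hypothesis q_panjer : forall m, m%:R * q m = panjer_sum lambda q m.

Let S n := \sum_(j < n) q j.

Let S_nd m n : (m <= n)%N -> S m <= S n.
Proof.
apply/nondecreasing_seqP: m n => n.
by rewrite /S big_ord_recr/= lerDl.
Qed.

Let S_le1 n : S n <= 1.
Proof.
rewrite -(cvg_lim _ q_sum)//; apply: (@nondecreasing_cvgn_le _ S) => //.
exact: cvgP q_sum.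
Qed.

Let S_shift x n : S (x + n) = S x + \sum_(i < n) q (x + i)%N.
Proof. by rewrite /S big_split_ord. Qed.

(** Panjer's recursion is summed over all indices from [x] on: each index on the left is at least
    [x], each shift on the right at most [r.+1]. The sum is taken over finite ranges before passing
    to the limit. *)
Lemma compound_tail_rec x : x%:R * (1 - S x) <=
  (\sum_(k < r.+1) k.+1%:R * lambda k) * (1 - S (x - r.+1)).
Proof.
have lim : x%:R * (S (n + x) - S x) @[n --> \oo] --> x%:R * (1 - S x).
  apply: cvgM; first exact: cvg_cst.
  by apply: cvgB; [rewrite (cvg_shiftn x S)|exact: cvg_cst].
apply: cvgr_to_le lim _; apply: nearW => n.
rewrite addnC S_shift addrC addKr mulr_sumr.
apply: (@le_trans _ _ (\sum_(i < n) panjer_sum lambda q (x + i))).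
  apply: ler_sum => i _; rewrite -q_panjer ler_wpM2r// ler_nat.
  exact: leq_addr.
rewrite /panjer_sum exchange_big/= mulr_suml; apply: ler_sum => k _.
rewrite -mulr_sumr ler_wpM2l ?mulr_ge0//.
have -> : \sum_(i < n) (if (k < x + i)%N then q (x + i - k.+1)%N else 0) =
    S (x + n - k.+1) - S (x - k.+1).
  elim: n => [|n IH]; first by rewrite big_ord0 addn0 subrr.
  rewrite big_ord_recr/= IH; case: ltnP => kx.
    by rewrite addnS subSn// /S big_ord_recr/= addrAC.
  have /eqP -> : (x + n - k.+1 == 0)%N by rewrite subn_eq0 ltnW.
  have /eqP -> : (x + n.+1 - k.+1 == 0)%N by rewrite subn_eq0 addnS.
  by rewrite addr0.
by rewrite lerB// S_nd// leq_sub2l.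
Qed.

Lemma compound_tail_le j : 1 - S (r.+1 * j) <=
  ((\sum_(k < r.+1) k.+1%:R * lambda k) / r.+1%:R) ^+ j / j`!%:R.
Proof.
set A := \sum_(k < r.+1) _.
have A_ge0 : 0 <= A by apply: sumr_ge0 => k _; rewrite mulr_ge0.
elim: j => [|j IH].
  by rewrite muln0 /S big_ord0 subr0 expr0 fact0 divr1.
have := compound_tail_rec (r.+1 * j.+1).
rewrite mulnS addKn -mulnS natrM -mulrA -/A => h.
have j0 : 0 < j.+1%:R :> R by [].
have r0 : 0 < r.+1%:R :> R by [].
rewrite factS natrM invfM mulrA exprS.
rewrite -(ler_pM2l r0) -(ler_pM2l j0) mulrCA.
apply: le_trans h _; apply: le_trans (ler_wpM2l A_ge0 IH) _.
rewrite le_eqVlt; apply/orP; left; apply/eqP; field.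
by rewrite !pnatr_eq0/= -lt0n fact_gt0 !nat1r !pnatr_eq0.
Qed.

(** The tail at [r.+1 * (2 * m)] is at most [B ^+ (2 * m) / (2 * m)!], and [(2 * m)! >= m! * m ^ m]
    beats any exponential factor. *)
Lemma compound_tail_small (delta : R) : (1 < r)%N -> 0 < delta ->
  exists2 m, (0 < m)%N /\ (r.+1 * (2 * m) <= 'C(m, r))%N &
    1 - S (r.+1 * (2 * m)) < (delta / 2) ^+ m / (2 * m`!%:R).
Proof.
move=> r1 d0; set A := \sum_(k < r.+1) k.+1%:R * lambda k.
(* [K] is chosen so that [B ^+ (2 * m) = K ^+ m * (delta / 2) ^+ m]; then [m > 2 * K] makes
   [(K / m) ^+ m] less than [1 / 2]. *)
pose B := A / r.+1%:R; pose K := B ^+ 2 * (2 / delta).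
have A_ge0 : 0 <= A by apply: sumr_ge0 => k _; rewrite mulr_ge0.
have B_ge0 : 0 <= B by rewrite divr_ge0.
have K_ge0 : 0 <= K by rewrite mulr_ge0 ?exprn_ge0// divr_ge0// ltW.
pose m := maxn (9 * r.+1 + r).+1 (Num.trunc (2 * K)).+1.
have m0 : (0 < m)%N by rewrite leq_max.
exists m; first split=> //.
  by apply: linear_leq_bin => //; rewrite (leq_trans (leqnSn _))// leq_maxl.
apply: le_lt_trans (compound_tail_le _) _; rewrite -/A -/B.
have mK : 2 * K < m%:R.
  by apply: lt_le_trans (truncnS_gt _) _; rewrite ler_nat leq_maxr.
have m0' : 0 < m%:R :> R by rewrite ltr0n.
have f0 : 0 < m`!%:R :> R by rewrite ltr0n fact_gt0.
apply: (@le_lt_trans _ _ (B ^+ (2 * m) / (m`!%:R * m%:R ^+ m))).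
  rewrite ler_wpM2l ?exprn_ge0//.
  have f2 : 0 < (2 * m)`!%:R :> R by rewrite ltr0n fact_gt0.
  have fm : 0 < m`!%:R * m%:R ^+ m :> R by rewrite mulr_gt0// exprn_gt0.
  by rewrite lef_pV2 ?posrE// -natrX -natrM ler_nat fact_exp_leq.
have -> : B ^+ (2 * m) / (m`!%:R * m%:R ^+ m) =
    (delta / 2) ^+ m / (2 * m`!%:R) * (2 * (K / m%:R) ^+ m).
  have -> : B ^+ (2 * m) = K ^+ m * (delta / 2) ^+ m.
    rewrite exprM -exprMn; congr (_ ^+ m); rewrite /K; field.
    by rewrite gt_eqF.
  rewrite [(K / _) ^+ m]exprMn [m%:R^-1 ^+ m]exprVn.
  have mm : m%:R ^+ m != 0 :> R by rewrite expf_neq0// gt_eqF.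
  by field; rewrite mm lt0r_neq0.
rewrite gtr_pMr; last by rewrite divr_gt0 ?mulr_gt0// exprn_gt0// divr_gt0.
have Km : K / m%:R < 1 / 2 by rewrite ltr_pdivrMr//; lra.
have Km0 : 0 <= K / m%:R by rewrite divr_ge0// ltW.
have : (K / m%:R) ^+ m <= K / m%:R.
  rewrite -[leRHS]expr1; apply: ler_wiXn2l => //.
  by apply: ltW (lt_trans Km _); lra.
by lra.
Qed.

Context (p : nat -> nat -> R) (c D : nat -> nat).
Hypothesis c_gt0 : forall n, (0 < c n)%N.
Hypothesis c_cvg : c n @[n --> \oo] --> \oo.
Hypothesis r_gt1 : (1 < r)%N.
Hypothesis p_cvg : forall m, p n m @[n --> \oo] --> q m.
Hypothesis p_tail : forall n m M e, (0 < e)%N -> (e <= D n)%N ->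
  (M <= 'C(m, r))%N ->
  'C(e, m)%:R * ((c n)%:R^-1 ^+ m * (1 - (c n)%:R^-1) ^+ (e - m)) <=
  1 - \sum_(j < M) p n j.

Lemma max_degree_negligible : (D n)%:R / (c n)%:R @[n --> \oo] --> (0 : R).
Proof.
apply/cvgr0Pnorm_lt => e e0.
(* The strict inequality [delta < e] leaves room for an integer degree above [delta * c n]; the cap
   [1 / 2] is for [binomial_lower]. *)
pose delta : R := Num.min (e / 2) (1 / 2).
have d0 : 0 < delta by rewrite lt_min !divr_gt0.
have d2 : delta <= 1 / 2 by rewrite ge_min lexx orbT.
have de : delta < e.
  by rewrite gt_min ltr_pdivrMr// ltr_pMr// ltr1n.
have [m [m0 mC] m_small] := compound_tail_small r_gt1 d0.
set M := (r.+1 * (2 * m))%N in mC m_small.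
have tail_cvg : 1 - \sum_(j < M) p n j @[n --> \oo] --> 1 - S M.
  by apply: cvgB; [exact: cvg_cst|apply: cvg_sum_ord => j; exact: p_cvg].
pose T := (Num.trunc (delta^-1 * (2 * m%:R) : R)).+1.
have cT : \forall n \near \oo, (T <= c n)%N.
  exact: (c_cvg (nbhs_infty_ge T)).
near=> n.
have c0 : 0 < (c n)%:R :> R by rewrite ltr0n.
rewrite ger0_norm ?divr_ge0// ltr_pdivrMr//.
have tail_lt : 1 - \sum_(j < M) p n j < (delta / 2) ^+ m / (2 * m`!%:R).
  by near: n; apply: (cvgr_lt _ tail_cvg).
have mc : 2 * m%:R <= delta * (c n)%:R.
  rewrite -ler_pdivrMl//.
  apply: ltW; apply: lt_le_trans (truncnS_gt _) _; rewrite ler_nat.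
  by near: n; exact: cT.
rewrite ltNge; apply/negP => Dn.
pose e' := (Num.trunc (delta * (c n)%:R)).+1.
have dc0 : 0 <= delta * (c n)%:R by rewrite mulr_ge0// ltW.
have /andP[e'_le /ltW e'_ge] := truncn_itv dc0.
have e'_le1 : e'%:R <= delta * (c n)%:R + 1 by rewrite -natr1 lerD2r.
have e'D : (e' <= D n)%N.
  rewrite /e' truncn_lt_nat//; apply: lt_le_trans Dn.
  by rewrite ltr_pM2r.
have low := binomial_lower d0 d2 m0 (c_gt0 n) mc e'_ge e'_le1.
have := le_lt_trans (p_tail (ltn0Sn _) e'D mC) tail_lt.
by rewrite ltNge low.
Unshelve. all: by end_near.
Qed.

End CompoundTail.

(** * Convergence in distribution through point masses *)

Section ConvergenceInLaw.
Context {R : realType}.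
Context (d : nat -> measure_display) (Omega : forall n, measurableType (d n)).
Context (P : forall n, probability (Omega n) R) (I : nat -> finType).
Context (X : forall n, I n -> {RV (P n) >-> nat}) (g : forall n, (I n -> nat) -> nat).
Context (d' : measure_display) (Omega' : measurableType d').
Context (Q : probability Omega' R) (J : finType).
Context (Z : J -> {RV Q >-> nat}) (h : (J -> nat) -> nat).

(** Half-integers lie between the jumps, hence are continuity points, and the cdf there gives the
    partial sums of the masses. Conversely the cdf at any point is 0 or a finite sum of masses. *)
Lemma cvg_in_distribution_law :
  cvg_in_distribution
    (fun n => apply_family R (@X n) (@g n) : {RV (P n) >-> R})
    (apply_family R Z h : {RV Q >-> R}) <->
  (forall m, law (@X n) (@g n) m @[n --> \oo] --> law Z h m).
Proof.
split=> [XZ m|XZ x _].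
  have cum M : \sum_(j < M) law (@X n) (@g n) j @[n --> \oo] --> \sum_(j < M) law Z h j.
    case: M => [|M].
      by under eq_fun do rewrite big_ord0; rewrite big_ord0; exact: cvg_cst.
    pose x : R := M%:R + 1 / 2.
    have truncx y : `|x - y| < 1 / 2 -> Num.trunc y = M /\ 0 <= y.
      have M0 : 0 <= M%:R :> R by [].
      rewrite ltr_norml /x => /andP[y1 y2].
      by split; [apply: truncn_def; rewrite -natr1; apply/andP; split; lra|lra].
    have [xM x0] : Num.trunc x = M /\ 0 <= x.
      by apply: truncx; rewrite subrr normr0 divr_gt0.
    have cdf_cont : {for x, continuous (cdf (apply_family R Z h : {RV Q >-> R}))}.
      apply: cvg_near_cst.
      near=> y; have [yM y0] : Num.trunc y = M /\ 0 <= y.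
        by apply: truncx; near: y; apply: cvgr_dist_lt; [exact: cvg_id|rewrite divr_gt0].
      by rewrite !cdf_law yM xM !ltNge y0 x0.
    have := XZ x cdf_cont; rewrite cdf_law xM ltNge x0/= => /fine_cvgP[_].
    apply: cvg_trans; apply: near_eq_cvg; near=> n.
    by rewrite /= cdf_law xM ltNge x0.
  rewrite (_ : law Z h m = \sum_(j < m.+1) law Z h j - \sum_(j < m) law Z h j); last first.
    by rewrite big_ord_recr/= addrAC subrr add0r.
  rewrite (_ : (fun n => _) = fun n => \sum_(j < m.+1) law (@X n) (@g n) j -
      \sum_(j < m) law (@X n) (@g n) j); last first.
    by apply/funext => n; rewrite big_ord_recr/= addrAC subrr add0r.
  exact: cvgB.
rewrite cdf_law; under eq_fun do rewrite cdf_law.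
case: (ltP x 0) => x0; first exact: cvg_cst.
apply: cvg_EFin; first exact: nearW.
by apply: cvg_sum_ord => j; exact: XZ.
Unshelve. all: by end_near.
Qed.

End ConvergenceInLaw.

(** * Equivalence of the density conditions and convergence in law *)

Unset Implicit Arguments.
Set Strict Implicit.

Theorem corollary1p1 (R : realType) (r : nat) (hr : (2 <= r)%N)
  (V : nat -> finType) (G : forall n, sgraph (V n))
  (c : nat -> nat) (hc0 : forall n, (0 < c n)%N) (hc : c n @[n --> \oo] --> \oo)
  (lambda : 'I_r.+1 -> R) (hlambda : forall k, 0 <= lambda k)
  (d : nat -> measure_display) (Omega : forall n, measurableType (d n))
  (P : forall n, probability (Omega n) R)
  (X : forall n, V n -> {RV (P n) >-> nat})
  (hXindep : forall n, mutually_independent (X n))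
  (hXunif : forall n v, uniform_on_1_to (c n) (X n v))
  (d' : measure_display) (Omega' : measurableType d')
  (Q : probability Omega' R)
  (Z : 'I_r.+1 -> {RV Q >-> nat})
  (hZindep : mutually_independent Z)
  (hZpois : forall k, poisson_distributed (lambda k) (Z k)) :
  ((forall k : 'I_r.+1,
      ((\sum_(F in star_classes r k.+1) num_induced F (G n))%N%:R
         / (c n)%:R ^+ r : R) @[n --> \oo] --> lambda k)
   /\ ((max_degree (G n))%:R / (c n)%:R : R) @[n --> \oo] --> (0 : R))
  <->
  cvg_in_distribution
    (fun n => apply_family R (X n) (mono_stars r (G n)) : {RV (P n) >-> R})
    (apply_family R Z (@weighted_sum r) : {RV Q >-> R}).
Proof.
have r_gt0 : (0 < r)%N by apply: ltnW.
pose p n m := law (X n) (mono_stars r (G n)) m.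
pose q m := law Z (@weighted_sum r) m.
pose mu n (k : 'I_r.+1) : R := star_density (c := c n) (r := r) (G n) k.
pose mean n := \sum_(k < r.+1) k.+1%:R * mu n k.
pose eps n : R := (2 * near_const r * max_degree (G n)).+1%:R / (c n)%:R.
have pE n m : p n m = count_prob (c := c n) (r := r) (G n) m.
  exact: (law_mono_stars r (G n) (hc0 n) (hXindep n) (hXunif n)).
have meanE n : mean n = count_mean (c := c n) (r := r) (G n).
  by rewrite count_meanE.
have p_ge0 n m : 0 <= p n m by exact: law_ge0.
have p_le1 n m : p n m <= 1 by exact: law_le1.
have mu_ge0 n k : 0 <= mu n k by exact: star_density_ge0.
have mean_ge0 n : 0 <= mean n by apply: sumr_ge0 => k _; rewrite mulr_ge0.
have q_ge0 m : 0 <= q m by exact: law_ge0.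
have q0_gt0 : 0 < q 0%N := compound_law0_gt0 hlambda hZindep hZpois.
have q_sum : \sum_(j < n) q j @[n --> \oo] --> (1 : R) by exact: sum_law_cvg1.
have q_panjer m : m%:R * q m = panjer_sum lambda q m := panjer hlambda hZindep hZpois m.
have sum_pE n M : \sum_(j < M) p n j =
    \sum_(j < M) count_prob (c := c n) (r := r) (G n) j.
  by apply: eq_bigr => j _; exact: pE.
have muE n (k : 'I_r.+1) : (\sum_(F in star_classes r k.+1) num_induced F (G n))%N%:R
    / (c n)%:R ^+ r = mu n k.
  by rewrite (sum_num_induced hr) mulrC -exprVn.
have c_inv : (c n)%:R^-1 @[n --> \oo] --> (0 : R).
  apply/(@gtr0_cvgV0 R _ \oo _ (fun n => (c n)%:R)).
    by apply: nearW => n; rewrite ltr0n.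
  exact: cvg_comp hc (@cvgr_idn R).
have eps_cvg : (max_degree (G n))%:R / (c n)%:R @[n --> \oo] --> (0 : R) ->
    eps n @[n --> \oo] --> (0 : R).
  move=> D0; rewrite (_ : eps = fun n => (2 * near_const r)%N%:R *
      ((max_degree (G n))%:R / (c n)%:R) + (c n)%:R^-1); last first.
    by apply/funext => n; rewrite /eps -natr1 natrM mulrDl mul1r mulrA.
  rewrite -[X in _ --> X](addr0 0); apply: cvgD => //.
  rewrite -[X in _ --> X](mulr0 (2 * near_const r)%N%:R).
  by apply: cvgM => //; exact: cvg_cst.
have err : (max_degree (G n))%:R / (c n)%:R @[n --> \oo] --> (0 : R) ->
    \forall n \near \oo, forall m,
    `|m%:R * p n m - panjer_sum (mu n) (p n) m| <= mean n * eps n.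
  move=> D0; near=> n => m; rewrite meanE pE.
  rewrite (_ : panjer_sum _ _ _ = panjer_sum (mu n)
      (count_prob (c := c n) (r := r) (G n)) m); last first.
    by apply: eq_bigr => k _; rewrite pE.
  apply: panjer_approx => //.
  (* [panjer_approx] asks for a maximum degree of at most [c n], which holds eventually. *)
  rewrite -(ler_nat R) -[leRHS]mul1r -ler_pdivrMr ?ltr0n//.
  by near: n; apply: (cvgr_le _ D0).
have p_panjer (C : R) : (max_degree (G n))%:R / (c n)%:R @[n --> \oo] --> (0 : R) ->
    (\forall n \near \oo, mean n <= C) -> forall m,
    m%:R * p n m - panjer_sum (mu n) (p n) m @[n --> \oo] --> (0 : R).
  move=> D0 mC m; apply: (@cvg0_normr_le _ _ (fun n => C * eps n)); last first.
    by rewrite -[X in _ --> X](mulr0 C); apply: cvgM; [exact: cvg_cst|exact: eps_cvg].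
  near=> n; apply: (@le_trans _ _ (mean n * eps n)).
    by have : forall m, `|m%:R * p n m - panjer_sum (mu n) (p n) m| <= mean n * eps n;
      [near: n; exact: err|exact].
  by rewrite ler_wpM2r//; [rewrite divr_ge0|near: n].
rewrite cvg_in_distribution_law; split=> [[mu_cvg D0] m|p_cvg].
  have {}mu_cvg k : mu n k @[n --> \oo] --> lambda k.
    by under eq_fun do rewrite -muE; exact: mu_cvg.
  have mean_cvg : mean n @[n --> \oo] --> \sum_(k < r.+1) k.+1%:R * lambda k.
    by apply: cvg_sum_ord => k; apply: cvgM; [exact: cvg_cst|exact: mu_cvg].
  pose C := \sum_(k < r.+1) k.+1%:R * lambda k + 1.
  have mC : \forall n \near \oo, mean n <= C.
    by apply: (cvgr_le _ mean_cvg); rewrite ltrDl ltr01.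
  apply: (panjer_cvg p_ge0 p_le1 _ _ q_ge0 q0_gt0 q_sum hlambda q_panjer
    (p_panjer C D0 mC) mu_cvg).
  - by move=> n M; rewrite sum_pE -/(mean n) meanE; exact: count_markov.
  - by move=> n M; rewrite sum_pE; exact: count_tail_ge0.
(* The degree condition comes first, as the error bound [err] rests on it. *)
have D0 : (max_degree (G n))%:R / (c n)%:R @[n --> \oo] --> (0 : R).
  apply: (max_degree_negligible q_ge0 q_sum hlambda q_panjer hc0 hc hr p_cvg).
  by move=> n m M e e0 eD Mm; rewrite sum_pE; exact: count_tail_max_degree.
(* Bounded means make the error in the recursion vanish, after which the rates can be read off. *)
split=> // k; have [C mC] := panjer_mean_bounded p_ge0 p_le1 mu_ge0 q0_gt0
  (err D0) (eps_cvg D0) (p_cvg 0%N).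
under eq_fun do rewrite muE.
exact: (panjer_cvg_rates q0_gt0 q_panjer (p_panjer C D0 mC) p_cvg).
Unshelve. all: by end_near.
Qed.
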